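(* There are at least $950$ periodic triangulations of $\mathbb{Z}^5$ up to $\mathrm{GL}_5(\mathbb{Z})$-equivalence; that is, there exist $950$ pairwise non-$\mathrm{GL}_5(\mathbb{Z})$-equivalent periodic triangulations of $\mathbb{Z}^5$.
   Context: A periodic triangulation of $\mathbb{Z}^n$ is a collection $\mathcal{T}$ of $n$-dimensional simplices in $\mathbb{R}^n$ whose set of vertices is $\mathbb{Z}^n$, which cover $\mathbb{R}^n$, such that the intersection of any two simplices of $\mathcal{T}$ is a (possibly empty) face of both, and such that $\mathcal{T}+v=\mathcal{T}$ for every $v\in\mathbb{Z}^n$. Two periodic triangulations $\mathcal{T},\mathcal{T}'$ of $\mathbb{Z}^n$ are $\mathrm{GL}_n(\mathbb{Z})$-equivalent if $\mathcal{T}'=g\mathcal{T}$ for some $g\in\mathrm{GL}_n(\mathbb{Z})$. *)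

(* Defs.v *)
From HB Require Import structures.
From mathcomp Require Import all_boot all_order all_algebra.
From mathcomp Require Import boolp classical_sets reals.

Set Implicit Arguments.
Unset Strict Implicit.
Unset Printing Implicit Defensive.

Import Order.TTheory GRing.Theory Num.Theory.

Local Open Scope classical_set_scope.
Local Open Scope ring_scope.

Definition affinely_independent (R : realType) (V : lmodType R) (k : nat)
    (v : 'I_k -> V) : Prop :=
  forall w : 'I_k -> R, \sum_i w i = 0 -> \sum_i w i *: v i = 0 ->
    forall i, w i = 0.

(* The convex hull of the points [v i] such that [P i]; it is empty when [P] is
   nowhere true. *)
Definition hull (R : realType) (V : lmodType R) (k : nat) (P : pred 'I_k)
    (v : 'I_k -> V) : set V :=
  [set x | exists w : 'I_k -> R,
     [/\ forall i, 0 <= w i,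
         \sum_(i | P i) w i = 1
       & x = \sum_(i | P i) w i *: v i]].

(* Simplices are sets of points; [simplex_on v S] says that [S] is the simplex
   with vertices [v 0, ..., v d]. *)
Definition simplex_on (R : realType) (V : lmodType R) (d : nat)
    (v : 'I_d.+1 -> V) (S : set V) : Prop :=
  affinely_independent v /\ S = hull predT v.

Definition is_simplex (R : realType) (V : lmodType R) (d : nat) (S : set V) :
    Prop :=
  exists v : 'I_d.+1 -> V, simplex_on v S.

Definition is_vertex (R : realType) (V : lmodType R) (d : nat) (S : set V)
    (x : V) : Prop :=
  exists2 v : 'I_d.+1 -> V, simplex_on v S & exists i, x = v i.

Definition is_face (R : realType) (V : lmodType R) (d : nat) (S F : set V) :
    Prop :=
  exists2 v : 'I_d.+1 -> V, simplex_on v S &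
    exists P : pred 'I_d.+1, F = hull P v.

Definition int_vec (R : realType) (n : nat) (z : 'cV[int]_n) : 'cV[R]_n :=
  map_mx intr z.

Definition translate (R : realType) (n : nat) (v : 'cV[R]_n)
    (T : set (set 'cV[R]_n)) : set (set 'cV[R]_n) :=
  [set [set x + v | x in S] | S in T].

Definition gl_image (R : realType) (n : nat) (g : 'M[int]_n)
    (T : set (set 'cV[R]_n)) : set (set 'cV[R]_n) :=
  [set [set map_mx intr g *m x | x in S] | S in T].

Record periodic_triangulation (R : realType) (n : nat)
    (T : set (set 'cV[R]_n)) : Prop := PeriodicTriangulation {
  ptri_simplex : forall S, T S -> is_simplex n S;
  ptri_vertices : \bigcup_(S in T) [set x | is_vertex n S x] = range (@int_vec R n);
  ptri_cover : \bigcup_(S in T) S = setT;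
  ptri_face : forall S1 S2, T S1 -> T S2 ->
    is_face n S1 (S1 `&` S2) /\ is_face n S2 (S1 `&` S2);
  ptri_periodic : forall z : 'cV[int]_n, translate (int_vec R z) T = T
}.

(* [unitmx] over [int] is the set of integer matrices with an integer inverse,
   that is, GL_n(Z). *)
Definition gl_equivalent (R : realType) (n : nat)
    (T T' : set (set 'cV[R]_n)) : Prop :=
  exists2 g : 'M[int]_n, g \in unitmx & T' = gl_image g T.

(* Main.v *)
Require Import Defs.
From HB Require Import structures.
From Stdlib Require Import ZArith FMapPositive.
From mathcomp Require Import all_boot all_order all_algebra.
From mathcomp Require Import boolp classical_sets reals.
From mathcomp Require Import zify ssrZ ring lra.

(* A triangulation is given by finitely many cells modulo translation. Such a
   list is a periodic triangulation as soon as every point of the space has a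
   unique expression as a convex combination of the vertices of a cell
   [triangulates]. Kuhn's triangulation, whose cells are cut out by the
   hyperplanes x_i = c and x_i - x_j = c with c an integer, has this property,
   and bistellar flips preserve it: if two multisets Zp and Zm of lattice points
   have the same size and the same sum, and the cells containing Zm are exactly
   the sets (Zp minus z), Zm, l for z in Zp and l in a list of links, then these
   cells can be replaced by Zp, (Zm minus z), l for z in Zm; convex combinations
   change by a multiple of the affine relation between Zp and Zm. Starting from
   Kuhn's triangulation, an explicit tree of flips reaches 950 triangulations.
   They are inequivalent because the numbers c(t) of cells containing a given
   triangle t, for t up to translation, have different statistics: a
   GL_5(Z)-equivalence transports these numbers. *)

Set Implicit Arguments.
Unset Strict Implicit.
Unset Printing Implicit Defensive.

Import Order.TTheory GRing.Theory Num.Theory.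

Local Open Scope classical_set_scope.
Local Open Scope ring_scope.
Local Delimit Scope Z_scope with coqZ.

(** * Weights on lattice points *)

(** Unique convex combinations are a convenient invariant because they need no determinant, volume
    or orientation. They give affine independence, since a relation among the vertices of a cell
    would provide the barycentre with further weights, and they give the face condition, since a
    common point of two cells has its weights on the common vertices. A flip has to be carried out
    at all lattice translates of a circuit at once, and flips at different translates might
    interfere. They do not when a cell contains at most one translate of [Zm], which is a finite
    test on the representatives. Uniqueness after a flip is obtained by undoing the flip, which
    works only because the amount of weight that was moved can be recovered. The search that
    produced the tree is not trusted: every flip is tested again when the tree is explored. Nor does
    anything depend on the numbers in the statistics: any choice gives an invariant, and a bad one
    could only make inequivalent triangulations look alike. Only integer points are evaluated; real
    numbers occur in the proofs of soundness alone. *)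

Lemma big_seq_support (A : eqType) (U : nmodType) (F : A -> U) (Y W : seq A) :
    uniq Y -> uniq W -> {subset Y <= W} -> (forall v, v \notin Y -> F v = 0) ->
  \sum_(v <- Y) F v = \sum_(v <- W) F v.
Proof.
move=> uY uW sYW F0.
rewrite [RHS](bigID (mem Y)) /= [X in _ + X]big1 ?addr0; last by move=> v /F0.
rewrite -[RHS]big_filter; apply: perm_big; apply: uniq_perm => //.
  exact: filter_uniq.
by move=> v; rewrite mem_filter; case: (boolP (v \in Y)) => // /sYW.
Qed.

Section Cells.

Variables (R : realType) (V : lmodType R) (A : zmodType).
Variable io : {additive A -> V}.
Implicit Types (S X Y W Z : seq A) (m : A -> R) (x : V) (t : A).
Implicit Types (L : seq (seq A)).

Definition shift t S := [seq v + t | v <- S].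

Lemma mem_shift t S v : (v \in shift t S) = (v - t \in S).
Proof.
by rewrite -[in LHS](subrK t v) /shift (mem_map (addIr t)).
Qed.

Lemma shift_uniq t S : uniq (shift t S) = uniq S.
Proof. exact: (map_inj_uniq (addIr t)). Qed.

(* The weights are functions on the whole lattice, so that those of different
   cells can be compared. *)
Definition rep Y m x :=
  [/\ forall v, 0 <= m v, forall v, v \notin Y -> m v = 0,
      \sum_(v <- Y) m v = 1 & x = \sum_(v <- Y) m v *: io v].

(** The order of [Y] is left free: normal forms reorder their points, and only the vertex set of a
    cell matters. *)
Definition cell L Y := exists S t, [/\ S \in L, uniq Y & Y =i shift t S].

Record triangulates L : Prop := Triangulates {
  tri_cover : forall x, exists Y m, cell L Y /\ rep Y m x;
  tri_unique : forall Y1 Y2 m1 m2 x, cell L Y1 -> cell L Y2 ->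
    rep Y1 m1 x -> rep Y2 m2 x -> m1 =1 m2 }.

(** Letting [W] range over all lists that contain [Z] makes [f] vanish outside [Z], so [f] is an
    affine relation among the points of [Z]. *)
Definition balanced Z (f : A -> R) := forall W, uniq W -> {subset Z <= W} ->
  \sum_(v <- W) f v = 0 /\ \sum_(v <- W) f v *: io v = 0.

(** An affine relation contributes neither to the total weight nor to the represented point. All
    sums are taken over one list [W] that contains both cells and the relation. *)
Lemma rep_balanced Z f (a : R) Y1 Y2 m1 m2 x :
    balanced Z f -> uniq Y1 -> uniq Y2 -> rep Y1 m1 x ->
    (forall v, m2 v = m1 v + a * f v) ->
    (forall v, 0 <= m2 v) -> (forall v, v \notin Y2 -> m2 v = 0) ->
  rep Y2 m2 x.
Proof.
move=> balf u1 u2 [m10 m1Y m11 ->] m2E m20 m2Y.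
pose W := undup (Y1 ++ Y2 ++ Z).
have uW : uniq W by apply: undup_uniq.
have s1 : {subset Y1 <= W} by move=> v vY; rewrite mem_undup mem_cat vY.
have s2 : {subset Y2 <= W}.
  by move=> v vY; rewrite mem_undup !mem_cat vY orbT.
have sZ : {subset Z <= W}.
  by move=> v vY; rewrite mem_undup !mem_cat vY !orbT.
have [f0 f1] := balf W uW sZ.
split=> //.
  rewrite (big_seq_support u2 uW s2 m2Y) -m11 (big_seq_support u1 uW s1 m1Y).
  under eq_bigr do rewrite m2E.
  by rewrite big_split /= -mulr_sumr f0 mulr0 addr0.
rewrite (big_seq_support u1 uW s1); last by move=> v /m1Y ->; rewrite scale0r.
rewrite (big_seq_support u2 uW s2); last by move=> v /m2Y ->; rewrite scale0r.
under [RHS]eq_bigr do rewrite m2E scalerDl -scalerA.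
by rewrite big_split /= -scaler_sumr f1 scaler0 addr0.
Qed.

Lemma sum_count_shift (U : lmodType R) Z t W (F : A -> U) :
    uniq W -> {subset shift t Z <= W} ->
  \sum_(v <- W) (count_mem (v - t) Z)%:R *: F v = \sum_(z <- Z) F (z + t).
Proof.
move=> uW; elim: Z => [|z Z IH] sZW.
  by rewrite big_nil big1 // => v _; rewrite /= scale0r.
rewrite big_cons -IH; last by move=> v vZ; apply: sZW; rewrite inE vZ orbT.
under eq_bigr do rewrite /= natrD scalerDl.
rewrite big_split /=; congr (_ + _).
rewrite (bigD1_seq (z + t)) //=; last by apply: sZW; rewrite inE eqxx.
rewrite addrK eqxx scale1r big1 ?addr0 // => v vz.
by rewrite eq_sym subr_eq (negPf vz) scale0r.
Qed.

End Cells.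

(** * Bistellar flips *)

Section FlipDef.

Variables (A : zmodType) (nf : seq A -> seq A) (Zp Zm : seq A).
Implicit Types (S X : seq A) (L : seq (seq A)).

(** If [Zm + t] lies in [S], then [z0 + t] is a point of [S]; this leaves finitely many candidates
    for [t]. *)
Definition translates S : seq A :=
  let z0 := head 0 Zm in
  [seq t <- [seq s - z0 | s <- S] | all (fun z => z + t \in S) Zm].

Definition split_star L :=
  let ts := [seq (X, translates X) | X <- L] in
  ([seq p.1 | p <- ts & nilp p.2], [seq p <- ts | ~~ nilp p.2]).

(** The cell is first moved so that its translate of [Zm] becomes [Zm] itself; only then can the
    links of different cells be compared. *)
Definition star_face (p : seq A * seq A) :=
  let X := shift (- head 0 p.2) p.1 in
  ([seq z <- undup Zp | z \notin X],
   [seq v <- X | (v \notin Zp) && (v \notin Zm)]).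

(* The result lists the removed, the new and the kept cells. Repetitions in [Zp]
   and [Zm] encode the coefficients of the affine relation. *)
Definition flip L : option (seq (seq A) * seq (seq A) * seq (seq A)) :=
  let: (keep, star) := split_star L in
  let faces := [seq star_face p | p <- star] in
  let Up := undup Zp in let Um := undup Zm in
  (* The links are read off the cells that miss the first point of [Zp]; the tests below force the
     other points of [Zp] to have the same links. *)
  let links := [seq f.2 | f <- faces & f.1 == [:: head 0 Up]] in
  let new := [seq nf ([seq v <- Up ++ Um | v != z] ++ l) | z <- Um, l <- links] in
  if [&& ~~ nilp Zp, ~~ nilp Zm, size Zp == size Zm,
         foldr +%R 0 Zp == foldr +%R 0 Zm,
         all (fun z => z \notin Zm) Zp,
         (* One translate of [Zm] per cell: flips at different translates then concern different
            cells. *)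
         all (fun p => size p.2 == 1%N) star,
         all (fun f => (size f.1 == 1%N) && (f.2 \in links)) faces,
         all (fun z => all (fun l => ([:: z], l) \in faces) links) Up,
         uniq new & all (fun S => S \notin keep) new]
  then Some ([seq p.1 | p <- star], new, keep) else None.

End FlipDef.

Lemma seq_argmin (A : eqType) (R : realDomainType) (f : A -> R) (s : seq A) :
  ~~ nilp s -> exists2 z, z \in s & {in s, forall y, f z <= f y}.
Proof.
elim: s => // a [_ _|b s /(_ isT) [z zs zmin] _].
  by exists a; rewrite ?inE // => y; rewrite inE => /eqP ->.
have [az|za] := lerP (f a) (f z).
  exists a; first by rewrite inE eqxx.
  by move=> y; rewrite inE => /predU1P[-> //|/zmin]; apply: le_trans.
exists z; first by rewrite inE zs orbT.
by move=> y; rewrite inE => /predU1P[->|/zmin //]; apply: ltW.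
Qed.

(** * Moving weights along a circuit *)

Section Slide.

Variables (R : realType) (V : lmodType R) (A : zmodType).
Variable io : {additive A -> V}.
Variables (P M : seq A).
Hypotheses (sizePM : size P = size M) (sumPM : \sum_(z <- P) z = \sum_(z <- M) z).
Hypothesis disjPM : {in P, forall z, z \notin M}.

(** The affine relation between the translates of [P] and [M] by [t], its coefficients being the
    multiplicities. *)
Definition circuit t v : R := (count_mem (v - t) P)%:R - (count_mem (v - t) M)%:R.

Lemma circuit_pos t v : v - t \in P -> 0 < circuit t v.
Proof.
move=> vP; rewrite /circuit.
have /count_memPn -> := disjPM vP.
by rewrite subr0 ltr0n -has_count has_pred1.
Qed.

Lemma circuit_neg t v : v - t \in M -> circuit t v < 0.
Proof.
move=> vM; rewrite /circuit.
have /count_memPn -> : v - t \notin P.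
  by apply/negP => /disjPM; rewrite vM.
by rewrite sub0r oppr_lt0 ltr0n -has_count has_pred1.
Qed.

Lemma circuit_out t v : v - t \notin P -> v - t \notin M -> circuit t v = 0.
Proof. by move=> /count_memPn vP /count_memPn vM; rewrite /circuit vP vM subrr. Qed.

(** The coefficients add up to 0 because the sizes agree. The points cancel because the sums agree
    and [io t] is added equally often on both sides. *)
Lemma circuit_balanced t : balanced io (shift t (P ++ M)) (circuit t).
Proof.
move=> W uW sW.
have sP : {subset shift t P <= W}.
  by move=> v; rewrite mem_shift => vP; apply: sW; rewrite mem_shift mem_cat vP.
have sM : {subset shift t M <= W}.
  by move=> v; rewrite mem_shift => vP; apply: sW; rewrite mem_shift mem_cat vP orbT.
split.
  have h Z : {subset shift t Z <= W} ->
      \sum_(v <- W) (count_mem (v - t) Z)%:R = (size Z)%:R :> R.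
    move=> sZ; have := @sum_count_shift R A R^o Z t W (fun=> 1) uW sZ.
    rewrite big_const_seq count_predT iter_addr_0 => <-.
    by apply: eq_bigr => v _; rewrite /GRing.scale /= mulr1.
  by rewrite sumrB h // h // sizePM subrr.
have h Z : {subset shift t Z <= W} ->
    \sum_(v <- W) (count_mem (v - t) Z)%:R *: io v =
    io (\sum_(z <- Z) z) + io t *+ size Z.
  move=> sZ; rewrite sum_count_shift // raddf_sum -[in RHS](count_predT Z).
  rewrite -iter_addr_0 -big_const_seq -big_split /=.
  by apply: eq_bigr => z _; rewrite raddfD.
under eq_bigr do rewrite scalerBl.
by rewrite sumrB h // h // sizePM sumPM subrr.
Qed.

(** Weight is moved from [P] to [M] until a first point of [P] has none left. Taking [P], [M] to be
    [Zm], [Zp] performs a flip; the other order undoes it. *)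
Lemma slide l t Y m x : ~~ nilp P -> uniq Y ->
    {subset Y <= shift t (P ++ M ++ l)} -> rep io Y m x ->
  exists tau, exists2 z, z \in P &
    [/\ 0 <= tau, m (z + t) - tau * circuit t (z + t) = 0 &
     forall Y', uniq Y' ->
       Y' =i shift t ([seq v <- undup P ++ undup M | v != z] ++ l) ->
       rep io Y' (fun v => m v - tau * circuit t v) x].
Proof.
move=> P0 uY sY repY.
have [m0 mY _ _] := repY.
(* The ratio test of the simplex method: the smallest quotient of weight by coefficient is the
   longest step that keeps the weights on [P] nonnegative. *)
have [z zP zmin] := seq_argmin (fun z => m (z + t) / circuit t (z + t)) P0.
have cz : 0 < circuit t (z + t) by apply: circuit_pos; rewrite addrK.
exists (m (z + t) / circuit t (z + t)), z => //; split.
- by rewrite divr_ge0 // ltW.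
- by rewrite divfK ?subrr // gt_eqF.
move=> Y' uY' Y'E.
set a := m (z + t) / _; pose m2 v := m v - a * circuit t v.
apply: (rep_balanced (a := - a) (m2 := m2) (circuit_balanced (t := t)) uY uY' repY).
- by move=> v; rewrite mulNr.
- move=> v; rewrite /m2; case: (boolP (v - t \in P)) => vP.
    have cv := circuit_pos vP.
    by rewrite subr_ge0 -ler_pdivlMr //; have := zmin _ vP; rewrite subrK.
  (* On [M] the coefficient is negative, so the weights there can only grow. *)
  case: (boolP (v - t \in M)) => vM.
    have cv := circuit_neg vM.
    rewrite subr_ge0; apply: le_trans (m0 v).
    by rewrite mulr_ge0_le0 ?divr_ge0 // ltW.
  by rewrite circuit_out // mulr0 subr0.
move=> v; rewrite /m2 Y'E mem_shift mem_cat negb_or mem_filter mem_cat !mem_undup.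
case: (eqVneq (v - t) z) => [vz _|vz /=].
  by rewrite -(subrK t v) vz divfK ?subrr // gt_eqF.
rewrite negb_or => /andP[/andP[vP vM] vl]; rewrite circuit_out // mulr0 subr0.
apply: mY; apply/negP => /sY.
by rewrite mem_shift !mem_cat (negPf vP) (negPf vM) (negPf vl).
Qed.

End Slide.

(** * A flip preserves triangulations *)

Section Flip.

Variables (R : realType) (V : lmodType R) (A : zmodType).
Variable io : {additive A -> V}.
Variable nf : seq A -> seq A.
Hypothesis nf_perm : forall S, exists t, perm_eq (nf S) (shift t S).
Variables (L old new0 keep0 : seq (seq A)) (Zp Zm : seq A).
Hypothesis uniqL : forall S, S \in L -> uniq S.
Hypothesis flipL : flip nf Zp Zm L = Some (old, new0, keep0).

Local Notation L' := (new0 ++ keep0).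

Local Notation Up := (undup Zp).
Local Notation Um := (undup Zm).
Local Notation star := (split_star Zm L).2.
Local Notation keep := (split_star Zm L).1.
Local Notation faces := [seq star_face Zp Zm p | p <- star].
Local Notation links := [seq f.2 | f <- faces & f.1 == [:: head 0 Up]].
Local Notation base z l := ([seq v <- Up ++ Um | v != z] ++ l).
Local Notation new := [seq nf (base z l) | z <- Um, l <- links].

Lemma flipP :
  [/\ L' = new ++ keep, ~~ nilp Zp, ~~ nilp Zm, size Zp = size Zm &
      \sum_(z <- Zp) z = \sum_(z <- Zm) z] /\
  [/\ {in Zp, forall z, z \notin Zm},
      {in star, forall p, size p.2 = 1%N},
      {in faces, forall f, (size f.1 = 1%N) /\ f.2 \in links},
      {in Up & links, forall z l, ([:: z], l) \in faces} &
      uniq new /\ {in new, forall S, S \notin keep}].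
Proof.
move: flipL; rewrite /flip [split_star _ _]surjective_pairing.
case: ifP => // /and5P[p0 m0 /eqP sz /eqP sumZ].
case/and5P=> /allP disj /allP one /allP fc fcs.
case/andP=> un /allP nk [_ <- <-].
split; first by split=> //; rewrite -!foldrE.
split=> //.
- by move=> p /one /eqP.
- by move=> f /fc /andP[/eqP].
- by move=> z l zU lU; move/allP: fcs => /(_ z zU) /allP /(_ l lU).
Qed.

Let E := flipP.1.
Let F := flipP.2.

Lemma flip_perm : perm_eq L (old ++ keep0).
Proof.
have [[L'E _ _ _ _] _] := flipP.
move: flipL; rewrite /flip [split_star _ _]surjective_pairing.
case: ifP => // _ [<- _ <-].
set ts := [seq (X, translates Zm X) | X <- L].
have p : perm_eq ([seq p <- ts | ~~ nilp p.2] ++ [seq p <- ts | nilp p.2]) ts.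
  by rewrite perm_catC; apply/permPl/perm_filterC.
by have := perm_map fst p; rewrite map_cat -map_comp map_id perm_sym.
Qed.

Lemma flip_uniq : uniq L -> uniq L'.
Proof.
have [[L'E _ _ _ _] [_ _ _ _ [un nk]]] := flipP.
rewrite (perm_uniq flip_perm) L'E !cat_uniq.
move: flipL; rewrite /flip [split_star _ _]surjective_pairing.
case: ifP => // _ [_ _ <-] /and3P[_ _ ->]; rewrite un andbT /=.
by apply/hasPn => S Sk; apply/negP => /nk; rewrite Sk.
Qed.

Lemma mem_translates S t : uniq S -> ~~ nilp Zm ->
  (t \in translates Zm S) = all (fun z => z + t \in S) Zm.
Proof.
move=> uS; rewrite /translates mem_filter; case: Zm => //= z Z _.
case: (boolP (z + t \in S)) => //= ztS.
rewrite andbC -[in X in X && _](addKr z t) addrC.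
by rewrite (mem_map (addIr _)) ztS.
Qed.

(** This is the use of the test on [size p.2]: two flips that affect the same cell take place at the
    same translate. *)
Lemma translates_inj S t1 t2 : S \in L ->
  {in Zm, forall z, z + t1 \in S} -> {in Zm, forall z, z + t2 \in S} -> t1 = t2.
Proof.
move=> SL h1 h2; have uS := uniqL SL.
have [_ _ m0 _ _] := E; have [_ one _ _ _] := F.
have i1 : t1 \in translates Zm S by rewrite mem_translates //; apply/allP.
have i2 : t2 \in translates Zm S by rewrite mem_translates //; apply/allP.
have : (S, translates Zm S) \in star.
  rewrite mem_filter /= map_f // andbT.
  by case: (translates Zm S) i1.
move/one => /=; move: i1 i2; case: (translates _ _) => [|a [|]] //=.
by rewrite !inE => /eqP -> /eqP ->.
Qed.

Definition disjoint_star (Y : seq A) := forall t, ~ {in Zm, forall z, z + t \in Y}.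

Lemma keepP S : (S \in keep) <-> S \in L /\ disjoint_star S.
Proof.
have [_ _ m0 _ _] := E.
split=> [/mapP[p]|[SL dS]].
  rewrite mem_filter => /andP[n2 /mapP[S' S'L pE]] SE; subst p S.
  rewrite /= in n2 *; split=> // t tS.
  have: t \in translates Zm S'.
    by rewrite mem_translates ?uniqL //; apply/allP.
  by rewrite (nilP n2).
apply/mapP; exists (S, translates Zm S) => //; rewrite mem_filter map_f // andbT.
rewrite /nilp; case tE: (translates Zm S) => [|t s] //=.
case: (dS t); apply/allP; rewrite -mem_translates ?uniqL //.
by rewrite tE inE eqxx.
Qed.

(* A star cell, in the position where it contains [Zm] itself. *)
Definition star_cell z l X :=
  [/\ uniq X, cell L X, z \in Zp, l \in links &
      X =i [seq v <- Up ++ Um | v != z] ++ l].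

(** The cell contains [Zm], misses exactly one point [z] of [Zp], and its points outside [Zp] and
    [Zm] are the link; so [z] and the link determine it. *)
Lemma star_faceP p : p \in star ->
  exists z, (star_face Zp Zm p).1 = [:: z] /\
    star_cell z (star_face Zp Zm p).2 (shift (- head 0 p.2) p.1).
Proof.
have [_ p0 m0 _ _] := E; have [disj one fc _ _] := F.
move=> ps; have [s1 linkf] := fc _ (map_f _ ps).
move: (ps); rewrite mem_filter => /andP[_ /mapP[S SL pE]].
have uS := uniqL SL.
have := one p ps; rewrite {1}pE /=; case tE: (translates _ _) => [|t [|]] // _.
have XE : shift (- head 0 p.2) p.1 = shift (- t) S by rewrite pE /= tE.
rewrite XE; set X := shift (- t) S.
have fE : star_face Zp Zm p = ([seq z <- Up | z \notin X],
                [seq v <- X | (v \notin Zp) && (v \notin Zm)]).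
  by rewrite /star_face XE.
have ZmX : {subset Zm <= X}.
  move=> z zZ; rewrite mem_shift opprK.
  have tS : t \in translates Zm S by rewrite tE inE.
  by move: tS; rewrite mem_translates // => /allP; apply.
move: linkf s1; rewrite fE /= => linkf.
case f1E: [seq z <- Up | z \notin X] => [|z [|]] // _.
have zf : z \in [seq z <- Up | z \notin X] by rewrite f1E inE.
move: (zf); rewrite mem_filter mem_undup => /andP[zX zZp].
exists z; split=> //; split=> //.
- by rewrite shift_uniq.
- by exists S, (- t); split=> //; rewrite shift_uniq.
move=> v; rewrite mem_cat mem_filter mem_cat !mem_undup mem_filter.
case: (boolP (v \in Zm)) => vm /=.
  rewrite andbF orbF orbT andbT ZmX //; apply/esym.
  by apply: contraNneq zX => <-; apply: ZmX.
rewrite orbF andbT; case: (boolP (v \in Zp)) => vp /=; last by rewrite andbF.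
rewrite orbF andbT; case: (boolP (v \in X)) => vX.
  by apply/esym; apply: contraNneq zX => <-.
have : v \in [seq z <- Up | z \notin X] by rewrite mem_filter vX mem_undup.
by rewrite f1E inE => ->.
Qed.

(** The star is complete. When a flip is undone, the point [z] of [Zp] that loses its weight is not
    known beforehand, so the cell must exist for each of them. *)
Lemma star_cell_ex z l : z \in Zp -> l \in links -> exists X, star_cell z l X.
Proof.
have [_ _ _ fcs _] := F; move=> zZ lL.
have zU : z \in Up by rewrite mem_undup.
have /mapP[p ps pE] := fcs z l zU lL.
have [z' []] := star_faceP ps; rewrite -pE /= => -[<-] sc.
by exists (shift (- head 0 p.2) p.1).
Qed.

Lemma star_cellP Y t : cell L Y -> {in Zm, forall z, z + t \in Y} ->
  exists z l X, star_cell z l X /\ Y =i shift t X.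
Proof.
have [_ p0 m0 _ _] := E; have [disj one fc _ _] := F.
move=> [S [s [SL uY YE]]] tY; have uS := uniqL SL.
have tS : t - s \in translates Zm S.
  rewrite mem_translates //; apply/allP => z zZ.
  by have := tY z zZ; rewrite YE mem_shift addrA.
have ps : (S, translates Zm S) \in star.
  rewrite mem_filter; apply/andP; split; first by case: (translates _ _) tS.
  exact: (map_f (fun X => (X, translates Zm X))).
have [z [_ sc]] := star_faceP ps.
exists z, (star_face Zp Zm (S, translates Zm S)).2.
exists (shift (- head 0 (translates Zm S)) S); split=> //.
have := one _ ps; move: tS; rewrite /=.
case tE: (translates Zm S) => [|t' [|]] //; rewrite inE => /eqP <- _ v.
by rewrite YE !mem_shift /= opprK addrA subrK.
Qed.

Let sPM : size Zp = size Zm. Proof. by have [] := E. Qed.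
Let sumPM : \sum_(z <- Zp) z = \sum_(z <- Zm) z. Proof. by have [] := E. Qed.
Let disj : {in Zp, forall z, z \notin Zm}. Proof. by have [] := F. Qed.
Let disj' : {in Zm, forall z, z \notin Zp}.
Proof. by move=> z zM; apply/negP => /disj; rewrite zM. Qed.

Hypothesis triL : triangulates io L.

Local Notation circ t v := (circuit R Zp Zm t v).

Lemma links_uniq l : l \in links -> uniq l.
Proof.
move/mapP=> [f]; rewrite mem_filter => /andP[_ /mapP[p ps ->]] ->.
by have [z' [_ [u _ _ _ _]]] := star_faceP ps; exact: filter_uniq.
Qed.

Lemma links_out l v : l \in links -> v \in l -> v \notin Zp /\ v \notin Zm.
Proof.
move/mapP=> [f]; rewrite mem_filter => /andP[_ /mapP[p ps ->]] ->.
by rewrite mem_filter => /andP[/andP[]].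
Qed.

Lemma new_uniq z l : z \in Zm -> l \in links -> uniq (base z l).
Proof.
move=> zM lL.
rewrite cat_uniq filter_uniq /=; last first.
  rewrite cat_uniq !undup_uniq andbT /=; apply/hasPn => v.
  by rewrite !mem_undup => /disj'.
rewrite links_uniq // andbT; apply/hasPn => v /(links_out lL)[vp vm].
by rewrite mem_filter mem_cat !mem_undup (negPf vp) (negPf vm) andbF.
Qed.

(** A new cell and a star cell with the same link both arise from [Up ++ Um] by dropping one point
    and adding the link. *)
Lemma flip_new_size d : (forall C, C \in L -> size C = d) ->
  forall C, C \in new0 ++ keep0 -> uniq C /\ size C = d.
Proof.
have [L'E p0 _ _ _] := E.
move=> sL C; rewrite L'E mem_cat => /orP[|/keepP[CL _]]; last first.
  by rewrite uniqL // sL.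
case/allpairsP=> [[z l] /= [zU lL ->]]; rewrite mem_undup in zU.
have [t pC] := nf_perm (base z l); rewrite (perm_uniq pC) (perm_size pC).
rewrite shift_uniq new_uniq //; split=> //; rewrite size_map.
have z1P : head 0 Zp \in Zp by case: Zp p0 => // a s _; rewrite inE eqxx.
have [X [uX [S [s [SL _ XE]]] _ _ XE']] := star_cell_ex z1P lL.
have <- : size X = d.
  by rewrite -(sL S SL) (perm_size (uniq_perm uX _ XE)) ?shift_uniq ?uniqL ?size_map.
have uU : uniq (Up ++ Um).
  rewrite cat_uniq !undup_uniq andbT /=; apply/hasPn => v.
  by rewrite !mem_undup => /disj'.
have size_base y : y \in Up ++ Um ->
    size (base y l) = ((size (Up ++ Um)).-1 + size l)%N.
  by move=> yU; rewrite size_cat -rem_filter // size_rem.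
rewrite size_base; last by rewrite mem_cat !mem_undup zU orbT.
rewrite -(size_base (head 0 Zp)); last by rewrite mem_cat mem_undup z1P.
rewrite (perm_size (uniq_perm uX _ XE')) // cat_uniq filter_uniq //=.
rewrite links_uniq // andbT; apply/hasPn => v /(links_out lL)[vp vm].
by rewrite mem_filter mem_cat !mem_undup (negPf vp) (negPf vm) andbF.
Qed.

Lemma flip_new_nf C : C \in new0 ++ keep0 -> C \in L \/ exists S, C = nf S.
Proof.
have [-> _ _ _ _] := E; rewrite mem_cat => /orP[|/keepP[]]; last by left.
by case/allpairsP=> [[z l] [_ _ ->]]; right; eexists.
Qed.

Lemma cell_flip_keep Y : cell L Y -> disjoint_star Y -> cell L' Y.
Proof.
have [L'E _ _ _ _] := E.
move=> [S [t [SL uY YE]]] dY; exists S, t; split=> //.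
rewrite L'E mem_cat; apply/orP; right; apply/keepP; split=> // s sS.
apply: (dY (s + t)) => z /sS; by rewrite YE mem_shift addrA addrK.
Qed.

Lemma cell_flip_new z l t : z \in Zm -> l \in links ->
  exists2 Y, cell L' Y & Y =i shift t (base z l).
Proof.
have [L'E _ _ _ _] := E.
move=> zM lL; exists (shift t (base z l)) => //.
have [s /perm_mem nfE] := nf_perm (base z l).
exists (nf (base z l)), (t - s); split=> //; last first.
- by move=> v; rewrite !mem_shift nfE mem_shift opprB (addrC s) addrA addrK.
- by rewrite shift_uniq new_uniq.
rewrite L'E mem_cat; apply/orP; left; apply/allpairsP.
by exists (z, l); rewrite mem_undup.
Qed.

Lemma cell_flipP Y : cell L' Y ->
  (cell L Y /\ disjoint_star Y) \/
  exists z l t, [/\ z \in Zm, l \in links & Y =i shift t (base z l)].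
Proof.
have [L'E _ _ _ _] := E.
move=> [S [t [SL' uY YE]]]; move: SL'; rewrite L'E mem_cat => /orP[|/keepP[SL dS]].
  move=> /allpairsP[[z l] /= [zU lL SE]]; right.
  rewrite mem_undup in zU.
  have [s /perm_mem nfE] := nf_perm (base z l).
  exists z, l, (s + t); split=> // v.
  by rewrite YE SE mem_shift nfE !mem_shift opprD addrA addrAC.
left; split; first by exists S, t.
move=> s sY; apply: (dS (s - t)) => z /sY.
by rewrite YE mem_shift addrA.
Qed.

(** A point of a flipped cell is slid along the reversed relation until a weight on [Zm] vanishes;
    the support then fits in a new cell. *)
Lemma flip_cover x : exists Y m, cell L' Y /\ rep io Y m x.
Proof.
have [_ p0 m0 _ _] := E.
have [Y [m [cY rY]]] := tri_cover triL x.
have uY : uniq Y by case: cY => S [t []].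
have [[t tY]|ntY] := pselect (exists t, {in Zm, forall z, z + t \in Y}); last first.
  exists Y, m; split=> //; apply: cell_flip_keep => // t tY.
  by apply: ntY; exists t.
have [z [l [X [[uX cX zP lL XE] YE]]]] := star_cellP cY tY.
have sY : {subset Y <= shift t (Zm ++ Zp ++ l)}.
  move=> v; rewrite YE !mem_shift XE !mem_cat mem_filter mem_cat !mem_undup.
  by case/orP=> [/andP[_ /orP[]] ->|->]; rewrite ?orbT.
have [tau [z' z'M [tau0 _ slideY]]] := slide (esym sPM) (esym sumPM) disj' m0 uY sY rY.
have [Y' cY' Y'E] := cell_flip_new t z'M lL.
have uY' : uniq Y' by case: cY' => S [s []].
exists Y', (fun v => m v - tau * circuit R Zm Zp t v); split=> //.
apply: slideY => // v.
by rewrite Y'E !mem_shift !mem_cat !mem_filter !mem_cat [(_ \in Um) || _]orbC.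
Qed.

(* [m'] is a weight on a cell of the new triangulation, and [m] the weight that
   represents the same point on a cell [Y] of the old one. If [Y] was flipped,
   then [m'] vanishes at a point of [Zm]: this determines [tau] from [m]. *)
Definition unflips m' m := exists Y t tau,
  [/\ cell L Y, uniq Y, 0 <= tau & forall v, m' v = m v + tau * circ t v] /\
  (forall v, v \notin Y -> m v = 0) /\
  ((disjoint_star Y /\ tau = 0) \/
   ({in Zm, forall z, z + t \in Y} /\ exists2 z, z \in Zm & m' (z + t) = 0)).

(** The weights of a new cell are slid until one on [Zp] vanishes, and [star_cell_ex] provides the
    old cell that is reached. *)
Lemma unflip Y' m' x : cell L' Y' -> rep io Y' m' x ->
  exists m Y, [/\ unflips m' m, cell L Y & rep io Y m x].
Proof.
have [_ p0 m0 _ _] := E.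
move=> cY' rY'; have uY' : uniq Y' by case: cY' => S [t []].
have [m'0 m'Y _ _] := rY'.
have [[cY dY]|[z [l [t [zM lL Y'E]]]]] := cell_flipP cY'.
  (* A kept cell is unflipped by a step of length 0, at an arbitrary translate. *)
  exists m', Y'; split=> //; exists Y', 0, 0; split.
    by split=> // v; rewrite mul0r addr0.
  by split=> //; left.
have sY : {subset Y' <= shift t (Zp ++ Zm ++ l)}.
  move=> v; rewrite Y'E !mem_shift !mem_cat mem_filter mem_cat !mem_undup.
  by case/orP=> [/andP[_ /orP[]] ->|->]; rewrite ?orbT.
have [tau [z' z'P [tau0 z'0 slideY]]] := slide sPM sumPM disj p0 uY' sY rY'.
have [X [uX [S [s [SL _ XE]]] _ _ XE']] := star_cell_ex z'P lL.
pose m v := m' v - tau * circ t v.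
have cY : cell L (shift t X).
  exists S, (s + t); split=> //; first by rewrite shift_uniq.
  by move=> v; rewrite mem_shift XE !mem_shift opprD addrA addrAC.
have rY : rep io (shift t X) m x.
  apply: slideY; first by rewrite shift_uniq.
  by move=> v; rewrite !mem_shift XE'.
exists m, (shift t X); split=> //; exists (shift t X), t, tau; split.
  by split; rewrite ?shift_uniq // => v; rewrite /m addrNK.
split; first by case: rY.
right; split.
  move=> y yM; rewrite mem_shift addrK XE' mem_cat mem_filter mem_cat !mem_undup.
  by rewrite yM orbT andbT; apply/orP; left; apply: contraTneq yM => ->; apply: disj.
exists z => //; apply: m'Y; rewrite Y'E mem_shift addrK mem_cat mem_filter eqxx /=.
by apply/negP => /(links_out lL)[_]; rewrite zM.
Qed.

(** The circuit is negative on [Zm] and [m1] is nonnegative, so [m] is positive on the translate of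
    [Zm] by [t1], which therefore lies in [Y2]. A cell has room for one translate only, whence
    [t1 = t2]; the zeros of [m1] and [m2] on it then determine the step. *)
Lemma unflips_eq_pos m1 m2 m Y1 t1 a1 Y2 t2 a2 :
    cell L Y1 -> cell L Y2 -> 0 < a1 -> 0 <= a2 ->
    (forall v, m1 v = m v + a1 * circ t1 v) ->
    (forall v, m2 v = m v + a2 * circ t2 v) ->
    (forall v, v \notin Y2 -> m v = 0) ->
    (exists2 z, z \in Zm & m1 (z + t1) = 0) ->
    (disjoint_star Y2 /\ a2 = 0) \/
      ({in Zm, forall z, z + t2 \in Y2} /\ exists2 z, z \in Zm & m2 (z + t2) = 0) ->
    (forall v, 0 <= m1 v) -> (forall v, 0 <= m2 v) ->
  m1 =1 m2.
Proof.
move=> c1 c2 a1_gt0 a2_ge0 m1E m2E mY2 [z1 z1M m1z] h2 m1_ge0 m2_ge0.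
have s12 : {in Zm, forall z, z + t1 \in Y2}.
  move=> z zM; case: (boolP (z + t1 \in Y2)) => // /mY2 mz.
  have := m1_ge0 (z + t1); rewrite m1E mz add0r pmulr_rge0 // leNgt.
  by rewrite circuit_neg // addrK.
case: h2 => [[d2 _]|[s22 [z2 z2M m2z]]]; first by case: (d2 t1).
have t12 : t1 = t2.
  case: c2 => [S [s [SL uS SE]]].
  apply: (addIr (- s)); apply: (translates_inj SL) => z zM.
    by have := s12 z zM; rewrite SE mem_shift addrA.
  by have := s22 z zM; rewrite SE mem_shift addrA.
subst t2.
have c1N : circ t1 (z1 + t1) < 0 by apply: circuit_neg => //; rewrite addrK.
have c2N : circ t1 (z2 + t1) < 0 by apply: circuit_neg => //; rewrite addrK.
have := m2_ge0 (z1 + t1); have := m1_ge0 (z2 + t1).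
move: m1z m2z; rewrite !m1E !m2E => e1 e2 i1 i2.
(* Nonnegativity of [m2] at the zero of [m1] gives [a2 <= a1]; exchanging the two gives
   [a1 <= a2]. *)
have a12 : a1 = a2 by nra.
by move=> v; rewrite m1E m2E a12.
Qed.

Lemma unflips_eq m1 m2 m : unflips m1 m -> unflips m2 m ->
  (forall v, 0 <= m1 v) -> (forall v, 0 <= m2 v) -> m1 =1 m2.
Proof.
move=> [Y1 [t1 [a1 [[c1 u1 a1_ge0 m1E] [mY1 h1]]]]].
move=> [Y2 [t2 [a2 [[c2 u2 a2_ge0 m2E] [mY2 h2]]]]] m1_ge0 m2_ge0.
have [a1_eq0|a1_neq0] := eqVneq a1 0; last first.
  have a1_gt0 : 0 < a1 by rewrite lt_def a1_neq0.
  apply: (unflips_eq_pos c1 c2 a1_gt0 a2_ge0 m1E m2E) => //.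
  by case: h1 => [[_ a10]|[]//]; rewrite a10 eqxx in a1_neq0.
have [a2_eq0|a2_neq0] := eqVneq a2 0; last first.
  have a2_gt0 : 0 < a2 by rewrite lt_def a2_neq0.
  apply: fsym; apply: (unflips_eq_pos c2 c1 a2_gt0 a1_ge0 m2E m1E) => //.
  by case: h2 => [[_ a20]|[]//]; rewrite a20 eqxx in a2_neq0.
by move=> v; rewrite m1E m2E a1_eq0 a2_eq0 !mul0r.
Qed.

(** For uniqueness, two weights of [x] on new cells are unflipped to weights on old cells. These
    coincide, and the common weight determines both of the original ones. *)
Theorem flip_triangulates : triangulates io L'.
Proof.
split; first exact: flip_cover.
move=> Y1 Y2 m1 m2 x c1 c2 r1 r2.
have [n1 [X1 [f1 d1 s1]]] := unflip c1 r1.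
have [n2 [X2 [f2 d2 s2]]] := unflip c2 r2.
have n12 := tri_unique triL d1 d2 s1 s2.
have [m1_ge0 _ _ _] := r1; have [m2_ge0 _ _ _] := r2.
apply: (unflips_eq f1 _ m1_ge0 m2_ge0).
by have <- : n2 = n1 by apply/funext => v; rewrite n12.
Qed.

End Flip.

(** * From lattice cells to simplices *)

Section SimplexVertices.

Variables (R : realType) (V : lmodType R).

Lemma hull_vertex k (v : 'I_k -> V) i : hull predT v (v i).
Proof.
exists (fun j => (j == i)%:R); split.
- by move=> j; rewrite ler0n.
- by rewrite (bigD1 i) //= eqxx big1 ?addr0 // => j /negPf ->.
- rewrite (bigD1 i) //= eqxx scale1r big1 ?addr0 // => j /negPf ->.
  by rewrite scale0r.
Qed.

(* An affinely independent family consists of the extreme points of its hull,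
   so it is determined by the hull. *)
Lemma vertex_unique k l (v : 'I_k -> V) (v' : 'I_l -> V) i :
    affinely_independent v -> hull predT v = hull predT v' ->
  exists j, v i = v' j.
Proof.
move=> iv hvv'.
have [w [w0 w1 wE]] : hull predT v' (v i) by rewrite -hvv'; apply: hull_vertex.
have /choice[u uP] : forall j, exists u : 'I_k -> R, [/\ forall c, 0 <= u c,
    \sum_c u c = 1 & v' j = \sum_c u c *: v c].
  by move=> j; have : hull predT v (v' j) by rewrite hvv'; apply: hull_vertex.
(* Expanding [v i] over the [v' j], and these over the [v c], gives an affine relation with
   coefficients [b]. *)
pose b c := \sum_j w j * u j c - (c == i)%:R.
have b0 : forall c, b c = 0.
  apply: iv; rewrite /b.
    rewrite sumrB exchange_big /= [X in _ - X](bigD1 i) //= eqxx.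
    rewrite [X in _ - (_ + X)]big1 ?addr0; last by move=> j /negPf ->.
    rewrite -[X in _ - X]w1 -sumrB big1 // => j _.
    by case: (uP j) => _ u1 _; rewrite -mulr_sumr u1 mulr1 subrr.
  under eq_bigr do rewrite scalerBl.
  rewrite sumrB [X in _ - X](bigD1 i) //= eqxx scale1r.
  rewrite [X in _ - (_ + X)]big1 ?addr0; last by move=> j /negPf ->; rewrite scale0r.
  under eq_bigr do rewrite scaler_suml.
  rewrite exchange_big /= [X in _ - X]wE -sumrB big1 // => j _.
  case: (uP j) => _ _ ->; rewrite scaler_sumr -sumrB big1 // => c _.
  by rewrite scalerA subrr.
have [j wj] : exists j, 0 < w j.
  apply/existsP; apply: contraT; rewrite negb_exists => /forallP wn.
  have : \sum_(j | predT j) w j = 0.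
    by apply: big1 => j _; apply: le_anti; rewrite w0 andbT leNgt wn.
  by rewrite w1 => /eqP; rewrite oner_eq0.
exists j; have [u0 u1 ->] := uP j.
have uc c : c != i -> u j c = 0.
  move=> ci; have := b0 c; rewrite /b (negPf ci) subr0 => /eqP.
  rewrite psumr_eq0; last by move=> y _; rewrite mulr_ge0 //; case: (uP y).
  by move/allP => /(_ j (mem_index_enum j)); rewrite mulf_eq0 gt_eqF //= => /eqP.
rewrite (bigD1 i) //= big1 ?addr0; last by move=> c /uc ->; rewrite scale0r.
suff -> : u j i = 1 by rewrite scale1r.
by rewrite -u1 (bigD1 i) //= big1 ?addr0 // => c /uc.
Qed.

End SimplexVertices.

(** * Convex hulls of lattice cells *)

Section Geometry.

Variables (R : realType) (V : lmodType R) (A : zmodType).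
Variable io : {additive A -> V}.
Implicit Types (S X Y W Z : seq A) (m : A -> R) (x : V) (t : A).
Implicit Types (L : seq (seq A)).

Definition geo Y : set V := [set x | exists m, rep io Y m x].

Definition vertices Y k : 'I_k -> V := fun i => io (nth 0 Y i).

Lemma hull_geo (Q : pred A) Y k : uniq Y -> size Y = k ->
  hull (fun i : 'I_k => Q (nth 0 Y i)) (@vertices Y k) = geo [seq v <- Y | Q v].
Proof.
move=> uY <-.
have sumE (U : nmodType) (F : A -> U) :
    \sum_(v <- [seq v <- Y | Q v]) F v =
    \sum_(i < size Y | Q (nth 0 Y i)) F (nth 0 Y i).
  by rewrite big_filter (big_nth 0) big_mkord.
apply/seteqP; split => x.
  move=> [w [w0 w1 ->]].
  (* Weights indexed by positions become weights on lattice points, extended by 0. *)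
  pose m v := if v \in [seq v <- Y | Q v]
    then (if insub (index v Y) is Some i then w i else 0) else 0.
  have mE (i : 'I_(size Y)) : Q (nth 0 Y i) -> m (nth 0 Y i) = w i.
    move=> Qi; rewrite /m mem_filter Qi mem_nth //= index_uniq //.
    by rewrite insubT //= => i'; congr w; apply: val_inj.
  exists m; split.
  - by move=> v; rewrite /m; case: ifP => // _; case: insubP => // *.
  - by move=> v; rewrite /m => /negPf ->.
  - by rewrite sumE -w1; apply: eq_bigr => i /mE.
  - by rewrite sumE; apply: eq_bigr => i /mE ->.
move=> [m [m0 _ m1 ->]]; exists (fun i => m (nth 0 Y i)); split=> //.
  by rewrite -m1 sumE.
by rewrite sumE.
Qed.

Lemma hull_geoT Y k : uniq Y -> size Y = k ->
  hull predT (@vertices Y k) = geo Y.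
Proof.
by move=> uY sY; rewrite (hull_geo predT uY sY) filter_predT.
Qed.

Section Triangulation.

Variable L : seq (seq A).
Hypothesis triL : triangulates io L.

(** The barycentre has the constant weight [a] and, for an affine relation [w], also the weights
    [a + b * w] with [b] small and positive; uniqueness makes [w] vanish. *)
Lemma cell_independent Y k : cell L Y -> size Y = k ->
  affinely_independent (@vertices Y k).
Proof.
move=> cY <- w w0 wv i.
have uY : uniq Y by case: cY => S [t []].
have kY : (0 < size Y)%N by case: (size Y) i => // -[].
pose a : R := (size Y)%:R^-1.
have a0 : 0 < a by rewrite invr_gt0 ltr0n.
(* The summand 1 makes [s] positive even for [w = 0]; dividing by [s] keeps each [b * w j] within
   [a] of 0. *)
pose s := 1 + \sum_j `|w j|.
have s0 : 0 < s by rewrite ltr_pwDl // sumr_ge0.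
pose b := a / s.
have b0 : 0 < b by rewrite divr_gt0.
have bw j : `|b * w j| <= a.
  rewrite normrM gtr0_norm // /b mulrAC ler_pdivrMr // ler_pM2l //.
  rewrite /s (bigD1 j) //= addrA [1 + _]addrC -addrA lerDl.
  by rewrite addr_ge0 // sumr_ge0.
have hullY := hull_geoT uY erefl.
pose ext (f : 'I_(size Y) -> R) v :=
  if insub (index v Y) is Some j then f j else 0.
have extE f (j : 'I_(size Y)) : ext f (nth 0 Y j) = f j.
  by rewrite /ext index_uniq // insubT //= => j'; congr f; apply: val_inj.
have sumE (U : nmodType) (F : A -> U) :
    \sum_(v <- Y) F v = \sum_(j < size Y) F (nth 0 Y j).
  by rewrite (big_nth 0) big_mkord.
have ext_out f v : v \notin Y -> ext f v = 0.
  by rewrite -index_mem /ext => nv; rewrite insubN.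
have suma : \sum_(j < size Y) a = 1.
  by rewrite sumr_const card_ord -mulr_natr mulVf // pnatr_eq0 -lt0n.
pose x := \sum_(j < size Y) a *: @vertices Y (size Y) j.
have r1 : rep io Y (ext (fun=> a)) x.
  split.
  - by move=> v; rewrite /ext; case: insubP => // *; apply: ltW.
  - exact: ext_out.
  - by rewrite sumE -suma; apply: eq_bigr => j _; rewrite extE.
  - by rewrite sumE; apply: eq_bigr => j _; rewrite extE.
have r2 : rep io Y (ext (fun j => a + b * w j)) x.
  split.
  - move=> v; rewrite /ext; case: insubP => // j _ _.
    by have := bw j; rewrite ler_norml => /andP[]; lra.
  - exact: ext_out.
  - rewrite sumE; under eq_bigr do rewrite extE.
    by rewrite big_split /= suma -mulr_sumr w0 mulr0 addr0.
  - rewrite sumE; under [RHS]eq_bigr do rewrite extE scalerDl -scalerA.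
    have wv' : \sum_(j < size Y) w j *: io (nth 0 Y j) = 0 by [].
    by rewrite big_split /= -[X in _ = _ + X]scaler_sumr wv' scaler0 addr0.
have := tri_unique triL cY cY r1 r2 (nth 0 Y i); rewrite !extE => /eqP.
by rewrite -subr_eq0 opprD addNKr oppr_eq0 mulf_eq0 gt_eqF //= => /eqP.
Qed.

Lemma cell_simplex Y d : cell L Y -> size Y = d.+1 ->
  simplex_on (@vertices Y d.+1) (geo Y).
Proof.
move=> cY sY; split; first exact: cell_independent.
by rewrite hull_geoT //; case: cY => S [t []].
Qed.

(** By uniqueness a common point has the same weights on both cells; they vanish outside either one,
    hence live on the common vertices. *)
Lemma geo_setI Y1 Y2 : cell L Y1 -> cell L Y2 ->
  geo Y1 `&` geo Y2 = geo [seq v <- Y1 | v \in Y2].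
Proof.
move=> c1 c2.
have u1 : uniq Y1 by case: c1 => S [t []].
have u2 : uniq Y2 by case: c2 => S [t []].
have sub_rep m x Y : uniq Y -> {subset [seq v <- Y1 | v \in Y2] <= Y} ->
    rep io [seq v <- Y1 | v \in Y2] m x -> rep io Y m x.
  move=> uY sY [m0 mY m1 ->].
  have uF : uniq [seq v <- Y1 | v \in Y2] by apply: filter_uniq.
  split=> //.
  - by move=> v vY; apply: mY; apply: contra vY => /sY.
  - by rewrite -(big_seq_support uF uY sY).
  - by rewrite (big_seq_support uF uY sY) // => v /mY ->; rewrite scale0r.
apply/seteqP; split=> x.
  move=> [[m1 r1] [m2 r2]].
  have m12 : m1 = m2 by apply/funext; apply: (tri_unique triL c1 c2 r1 r2).
  subst m2; exists m1; case: r1 r2 => m0 mY1 s1 -> [_ mY2 _ _].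
  have uF : uniq [seq v <- Y1 | v \in Y2] by apply: filter_uniq.
  have sY : {subset [seq v <- Y1 | v \in Y2] <= Y1}.
    by move=> v; rewrite mem_filter => /andP[].
  have mF v : v \notin [seq v <- Y1 | v \in Y2] -> m1 v = 0.
    by rewrite mem_filter negb_and => /orP[/mY2|/mY1].
  split=> //; first by rewrite (big_seq_support uF u1 sY).
  by rewrite -(big_seq_support uF u1 sY) // => v /mF ->; rewrite scale0r.
by move=> [m r]; split; exists m; apply: sub_rep r => // v;
  rewrite mem_filter => /andP[].
Qed.

End Triangulation.

Definition cells_of L : set (set V) := [set geo Y | Y in cell L].

Lemma cell_size L Y k : (forall S, S \in L -> uniq S /\ size S = k) ->
  cell L Y -> size Y = k.
Proof.
move=> sL [S [t [SL uY YE]]]; have [uS <-] := sL S SL.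
by rewrite (perm_size (uniq_perm uY _ YE)) ?shift_uniq ?size_map.
Qed.

Lemma cell_shift L Y t : cell L Y -> cell L (shift t Y).
Proof.
move=> [S [s [SL uY YE]]]; exists S, (s + t); split=> //.
  by rewrite shift_uniq.
by move=> v; rewrite !mem_shift YE mem_shift opprD addrA addrAC.
Qed.

(** Asking [f] to respect only combinations of total weight 1 covers translations as well as linear
    maps. *)
Lemma rep_map (V' : lmodType R) (A' : zmodType) (io' : {additive A' -> V'})
    (h : A -> A') (h' : A' -> A) (f : V -> V') Y m x :
    cancel h h' -> cancel h' h ->
    (forall w, \sum_(v <- Y) w v = 1 ->
      f (\sum_(v <- Y) w v *: io v) = \sum_(v <- Y) w v *: io' (h v)) ->
  rep io Y m x -> rep io' [seq h v | v <- Y] (m \o h') (f x).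
Proof.
move=> hK h'K fE [m0 mY m1 ->]; split=> /=.
- by move=> v; apply: m0.
- move=> v vY; apply: mY; apply: contra vY => vY.
  by apply/mapP; exists (h' v).
- by rewrite big_map; under eq_bigr do rewrite hK.
- by rewrite fE // big_map; apply: eq_bigr => v _; rewrite hK.
Qed.

Lemma geo_shift Y t : geo (shift t Y) = [set x + io t | x in geo Y].
Proof.
have key Z s m x : rep io Z m x ->
    rep io (shift s Z) (m \o (fun v => v - s)) (x + io s).
  apply: (rep_map (f := fun x => x + io s)); [exact: addrK|exact: subrK|].
  move=> w w1; rewrite -[io s]scale1r -w1 scaler_suml -big_split /=.
  by apply: eq_bigr => v _; rewrite raddfD scalerDr.
apply/seteqP; split=> x.
  move=> [m r]; exists (x - io t); last by rewrite subrK.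
  have := key _ (- t) _ _ r; rewrite /shift -map_comp.
  rewrite (eq_map (g := id)) ?map_id; last by move=> v /=; rewrite addrK.
  by rewrite (raddfN io) => r'; eexists; exact: r'.
by move=> [y [m r] <-]; exists (m \o (fun v => v - t)); apply: key.
Qed.

End Geometry.

(** * Periodic triangulations from lists of cells *)

Section Lattice.

Variables (R : realType) (n : nat) (A : zmodType).
Variable io : {additive A -> 'cV[R]_n}.
Variables (f : A -> 'cV[int]_n) (f' : 'cV[int]_n -> A).
Hypotheses (fK : cancel f f') (f'K : cancel f' f).
Hypothesis ioE : forall a, io a = int_vec R (f a).
Implicit Types (L : seq (seq A)).

Definition good_cells L := [/\ triangulates io L, uniq L &
  forall C, C \in L -> uniq C /\ size C = n.+1].

Lemma io_inj : injective io.
Proof.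
move=> a b; rewrite !ioE => /matrixP fab; apply: (can_inj fK).
by apply/matrixP => i j; have := fab i j; rewrite !mxE => /intr_inj.
Qed.

Lemma cells_of_triangulation L : good_cells L ->
  periodic_triangulation (cells_of io L).
Proof.
move=> [triL _ sizeL].
have cell_uniq Y : cell L Y -> uniq Y by case=> S [t []].
split.
- move=> S [Y cY <-]; exists (@vertices _ _ _ io Y n.+1).
  exact: cell_simplex triL _ _ cY (cell_size sizeL cY).
- apply/seteqP; split=> x.
    move=> [S [Y cY <-]] [v [iv geoE] [i ->]].
    have [_ geoE'] := cell_simplex triL cY (cell_size sizeL cY).
    have [j ->] := vertex_unique i iv (etrans (esym geoE) geoE').
    by exists (f (nth 0 Y j)) => //; rewrite -ioE.
  move=> [z _ <-].
  (* Any cell will do: it is translated so that its first point becomes [f' z]. *)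
  have [Y [m [cY _]]] := tri_cover triL 0.
  have sY := cell_size sizeL cY.
  pose t := f' z - head 0 Y.
  exists (geo io (shift t Y)); first by exists (shift t Y) => //; apply: cell_shift.
  have cS : cell L (shift t Y) by apply: cell_shift.
  exists (@vertices _ _ _ io (shift t Y) n.+1).
    exact: cell_simplex triL _ _ cS (cell_size sizeL cS).
  exists ord0; rewrite /vertices /= /shift.
  by case: Y sY @t {cY cS} => //= a Y _; rewrite addrC subrK ioE f'K.
- apply/seteqP; split=> // x _.
  by have [Y [m [cY r]]] := tri_cover triL x; exists (geo io Y); [exists Y|exists m].
- suff face Y1 Y2 : cell L Y1 -> cell L Y2 ->
      is_face n (geo io Y1) (geo io Y1 `&` geo io Y2).
    move=> _ _ [Y1 c1 <-] [Y2 c2 <-]; split; first exact: face.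
    by rewrite setIC; apply: face.
  move=> c1 c2; have s1 := cell_size sizeL c1.
  exists (@vertices _ _ _ io Y1 n.+1); first exact: cell_simplex triL _ _ c1 s1.
  exists (fun i : 'I_n.+1 => nth 0 Y1 i \in Y2).
  by rewrite (hull_geo io (mem Y2)) ?(geo_setI triL c1 c2) //; apply: cell_uniq.
- move=> z; rewrite /translate.
  have zE : int_vec R z = io (f' z) by rewrite ioE f'K.
  apply/seteqP; split=> S.
    move=> [_ [Y cY <-] <-]; rewrite zE -geo_shift.
    by exists (shift (f' z) Y) => //; apply: cell_shift.
  move=> [Y cY <-]; exists (geo io (shift (- f' z) Y)).
    by exists (shift (- f' z) Y) => //; apply: cell_shift.
  rewrite zE -geo_shift /shift -map_comp (eq_map (g := id)) ?map_id // => v /=.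
  by rewrite subrK.
Qed.

(** * Equivalences as bijections between lists of cells *)

Section Equivalence.

Variable nf : seq A -> seq A.
Hypothesis nf_perm : forall C, exists t, perm_eq (nf C) (shift t C).
Hypothesis nf_eq : forall C D t, perm_eq D (shift t C) -> nf C = nf D.

Lemma nfP C D : nf C = nf D -> exists t, perm_eq D (shift t C).
Proof.
have [s sC] := nf_perm C; have [t tD] := nf_perm D => nfCD.
rewrite perm_sym in tD; rewrite nfCD in sC.
exists (s - t); have h := perm_trans tD sC.
have := perm_map (fun v => v - t) h; rewrite -!map_comp.
have -> : map ((fun v => v - t) \o (fun v => v + t)) D = D.
  by rewrite -[RHS]map_id; apply: eq_map => v /=; rewrite addrK.
by congr perm_eq; apply: eq_map => v /=; rewrite addrA.
Qed.

Definition normal_cells L := good_cells L /\ {in L, forall C, nf C = C}.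

(** The hypothesis equates sets of simplices, the conclusion compares lists of cells. The passage
    goes through the vertices, which a simplex determines by [vertex_unique]; normal forms then
    single out one list in each translation class. *)
Lemma gl_equivalent_cells L L' : normal_cells L -> normal_cells L' ->
    gl_equivalent (cells_of io L) (cells_of io L') ->
  exists h : A -> A, [/\ {morph h : a b / a + b}, bijective h &
    perm_eq L' [seq nf [seq h v | v <- C] | C <- L]].
Proof.
move=> [[triL uL sL] nL] [[triL' uL' sL'] nL'] [g gU TE].
pose h a := f' (g *m f a); pose h' a := f' (invmx g *m f a).
have hK : cancel h h' by move=> a; rewrite /h /h' f'K mulKmx.
have h'K : cancel h' h by move=> a; rewrite /h /h' f'K mulKVmx.
pose gR : 'M[R]_n := map_mx intr g.
have ioh a : io (h a) = gR *m io a.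
  by rewrite !ioE f'K /int_vec map_mxM.
have hD : {morph h : a b / a + b}.
  by move=> a b; apply: io_inj; rewrite !(ioh, raddfD).
have gR_inj (x y : 'cV[R]_n) : gR *m x = gR *m y -> x = y.
  move=> xy; suff gU' : map_mx intr (invmx g) *m gR = 1%:M.
    by rewrite -[x]mul1mx -[y]mul1mx -gU' -!mulmxA xy.
  by rewrite -map_mxM mulVmx // map_mx1.
have shift_h t C : shift (h t) (map h C) = map h (shift t C).
  by rewrite /shift -!map_comp; apply: eq_map => v /=; rewrite hD.
have geoh Y : geo io (map h Y) = [set gR *m x | x in geo io Y].
  apply/seteqP; split=> x.
    move=> [m r]; exists (map_mx intr (invmx g) *m x).
      suff : rep io (map h' (map h Y)) (m \o h) (map_mx intr (invmx g) *m x).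
        by rewrite (mapK hK) => r'; exists (m \o h).
      apply: (rep_map (f := mulmx (map_mx intr (invmx g)))) r => // w _.
      rewrite mulmx_sumr; apply: eq_bigr => v _; rewrite -scalemxAr.
      by rewrite !ioE f'K /int_vec map_mxM.
    by rewrite mulmxA -map_mxM mulmxV // map_mx1 mul1mx.
  move=> [y [m r] <-]; exists (m \o h').
  apply: (rep_map (f := mulmx gR)) r => // w _.
  by rewrite mulmx_sumr; apply: eq_bigr => v _; rewrite -scalemxAr ioh.
(* Past the end of a list [nth] returns its default [0], which [h] has to preserve. *)
have h0 : h 0 = 0 by apply: io_inj; rewrite ioh !raddf0.
have vertex_h Y i : io (nth 0 (map h Y) i) = gR *m io (nth 0 Y i).
  by rewrite -ioh; congr (io _); elim: Y i => [|a Y IH] [|i] //=.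
have geo_inj Y Y' : cell L Y -> cell L' Y' -> geo io Y' = geo io (map h Y) ->
    perm_eq Y' (map h Y).
  move=> cY cY' geoE.
  have uY : uniq (map h Y).
    by rewrite (map_inj_uniq (can_inj hK)); case: cY => C [t []].
  have sY := cell_size sL cY; have sY' := cell_size sL' cY'.
  have sh : size (map h Y) = n.+1 by rewrite size_map.
  have [iY' hY'] := cell_simplex triL' cY' sY'.
  have ih : affinely_independent (@vertices _ _ _ io (map h Y) n.+1).
    move=> w w0 wv; have [iY _] := cell_simplex triL cY sY.
    apply: iY => //; apply: gR_inj; rewrite mulmx0 mulmx_sumr -[RHS]wv.
    by apply: eq_bigr => i _; rewrite /vertices vertex_h scalemxAr.
  rewrite geoE -(hull_geoT io uY sh) in hY'.
  apply: uniq_perm => //; first by case: cY' => C [t []].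
  move=> v; apply/idP/idP => vY.
    have iv : (index v Y' < n.+1)%N by rewrite -sY' index_mem.
    have [j] := vertex_unique (Ordinal iv) iY' (esym hY').
    rewrite /vertices /= nth_index // => /io_inj ->.
    by rewrite mem_nth ?sh.
  have iv : (index v (map h Y) < n.+1)%N by rewrite -sh index_mem.
  have [j] := vertex_unique (Ordinal iv) ih hY'.
  rewrite /vertices /= nth_index // => /io_inj ->.
  by rewrite mem_nth ?sY'.
exists h; split=> //; first by exists h'.
apply: uniq_perm => //.
  rewrite map_inj_in_uniq // => C D CL DL /nfP[t].
  (* Every translation vector is of the form [h (h' t)], so [h] can be cancelled. *)
  rewrite -[t]h'K shift_h => /(perm_map_inj (can_inj hK)) /nf_eq.
  by rewrite !nL.
have cellL C : C \in L -> cell L C.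
  move=> CL; exists C, 0; split=> //; first by case: (sL C CL).
  by move=> v; rewrite mem_shift subr0.
have cellL' C : C \in L' -> cell L' C.
  move=> CL; exists C, 0; split=> //; first by case: (sL' C CL).
  by move=> v; rewrite mem_shift subr0.
have cell_perm (M : seq (seq A)) Y :
    (forall C, C \in M -> uniq C /\ size C = n.+1) -> cell M Y ->
    exists C t, C \in M /\ perm_eq Y (shift t C).
  move=> sM [C [t [CM uY YE]]]; exists C, t; split=> //.
  by apply: uniq_perm => //; rewrite shift_uniq; case: (sM C CM).
move=> D; apply/idP/mapP => [DL'|[C CL ->]].
  have : cells_of io L' (geo io D) by exists D => //; apply: cellL'.
  rewrite TE => -[_ [Y cY <-]]; rewrite -geoh => /esym DY.
  have pD := geo_inj Y D cY (cellL' D DL') DY.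
  have [C [t [CL pY]]] := cell_perm L Y sL cY.
  exists C => //; rewrite -[D]nL' //; apply/esym.
  apply: (nf_eq (t := h t)); apply: perm_trans pD _.
  by rewrite shift_h; apply: perm_map.
have : cells_of io L' (geo io (map h C)).
  by rewrite TE geoh; exists (geo io C) => //; exists C => //; apply: cellL.
move=> [Y' cY' YE].
have pY := geo_inj C Y' (cellL C CL) cY' YE.
have [D' [t [DL' pY']]] := cell_perm L' Y' sL' cY'.
suff -> : nf (map h C) = D' by [].
rewrite -[D']nL' //; apply/esym; apply: (nf_eq (t := t)).
by apply: perm_trans pY'; rewrite perm_sym.
Qed.

End Equivalence.
End Lattice.

(** * Statistics of triangles *)

Fixpoint subs (T : Type) k (s : seq T) : seq (seq T) :=
  match k, s with
  | 0%N, _ => [:: [::]]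
  | _, [::] => [::]
  | k'.+1, x :: s' => map (cons x) (subs k' s') ++ subs k s'
  end.

Lemma subs0 (T : Type) (s : seq T) : subs 0 s = [:: [::]].
Proof. by case: s. Qed.

Lemma subs_map (T T' : Type) (h : T -> T') k s :
  subs k (map h s) = map (map h) (subs k s).
Proof.
elim: s k => [|x s IH] [|k] //=.
by rewrite map_cat !IH -!map_comp.
Qed.

(** Permuting [s] also permutes the entries inside the sublists, which [h] does not see. It is
    enough to move one element to the front, the claim [front]; induction does the rest. *)
Lemma perm_subs (T T' : eqType) (h : seq T -> T') k s s' :
    (forall t t', perm_eq t t' -> h t = h t') -> perm_eq s s' ->
  perm_eq (map h (subs k s)) (map h (subs k s')).
Proof.
move=> hE ss'.
have front : forall s1 x s2 k (h : seq T -> T'),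
    (forall t t', perm_eq t t' -> h t = h t') ->
    perm_eq (map h (subs k (s1 ++ x :: s2))) (map h (subs k (x :: s1 ++ s2))).
  elim=> [|y s1 IH] x s2 [|j] {}h {}hE //=.
  have hcons z : forall t t', perm_eq t t' -> (h \o cons z) t = (h \o cons z) t'.
    by move=> t t' tt'; apply: hE; rewrite /= perm_cons.
  rewrite !map_cat -!map_comp.
  apply: perm_trans (perm_cat (IH x s2 j _ (hcons y)) (IH x s2 j.+1 _ hE)) _.
  case: j => [|j] /=.
    by rewrite !subs0 /=; apply: permEl (perm_catCA [:: _] [:: _] _).
  rewrite !map_cat -!map_comp -!catA.
  have -> : map ((h \o cons y) \o cons x) (subs j (s1 ++ s2)) =
            map ((h \o cons x) \o cons y) (subs j (s1 ++ s2)).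
    apply: eq_map => t /=; apply: hE.
    exact: permEl (perm_catCA [:: y] [:: x] _).
  by rewrite perm_cat2l; apply: permEl (perm_catCA _ _ _).
elim: s s' k h hE ss' => [|x s IH] s' k h hE ss'.
  by rewrite perm_sym in ss'; rewrite (perm_nilP ss').
have xs' : x \in s' by rewrite -(perm_mem ss') inE eqxx.
case/splitPr: xs' ss' => s1 s2 ss'.
apply: perm_trans (_ : perm_eq _ (map h (subs k (x :: s1 ++ s2)))) _; last first.
  by rewrite perm_sym; apply: front.
have {}ss' : perm_eq s (s1 ++ s2).
  by move: ss'; rewrite perm_sym -(cat1s x s2) perm_catCA perm_cons perm_sym.
case: k => [|k] //=; rewrite !map_cat -!map_comp; apply: perm_cat; apply: IH => //.
by move=> t t' tt'; apply: hE; rewrite /= perm_cons.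
Qed.

Section Profile.

Variables (U : zmodType) (W : nat -> U).

(** Each distinct element contributes a partial sum of [W], so that adding one copy of [k] changes
    the profile by [W] at the old multiplicity of [k]. This makes updates cheap. *)
Definition profile (T : eqType) (D : seq T) : U :=
  \sum_(k <- undup D) \sum_(i < count_mem k D) W i.

Lemma profile_perm (T : eqType) (D D' : seq T) :
  perm_eq D D' -> profile D = profile D'.
Proof.
move=> DD'; rewrite /profile (perm_big _ (perm_undup (perm_mem DD'))) /=.
by apply: eq_bigr => k _; rewrite (permP DD').
Qed.

Lemma count_map_inj_in (T T' : eqType) (h : T -> T') (D : seq T) k :
  {in D &, injective h} -> k \in D -> count_mem (h k) (map h D) = count_mem k D.
Proof.
move=> hI kD; rewrite count_map; apply: eq_in_count => j jD /=.
by apply/eqP/eqP => [/hI -> //|->].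
Qed.

Lemma profile_map (T T' : eqType) (h : T -> T') (D : seq T) :
  {in D &, injective h} -> profile (map h D) = profile D.
Proof.
move=> hI; rewrite /profile.
have -> : undup (map h D) = map h (undup D).
  elim: D hI => //= x D IH hI.
  have hID : {in D &, injective h}.
    by move=> y z yD zD; apply: hI; rewrite inE ?yD ?zD orbT.
  have -> : (h x \in map h D) = (x \in D).
    apply/mapP/idP => [[y yD xy]|xD]; last by exists x.
    by rewrite (hI x y) ?inE ?eqxx ?yD ?orbT.
  by case: ifP => _ /=; rewrite IH.
rewrite big_map big_seq [RHS]big_seq; apply: eq_bigr => k.
by rewrite mem_undup => kD; rewrite count_map_inj_in.
Qed.

Lemma profile_cons (T : eqType) k (D : seq T) :
  profile (k :: D) = profile D + W (count_mem k D).
Proof.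
rewrite /profile /=; case: ifP => kD; last first.
  rewrite big_cons eqxx addrC; congr (_ + _).
    rewrite big_seq [RHS]big_seq; apply: eq_bigr => j; rewrite mem_undup.
    by case: eqP => [<-|_ _]; rewrite ?kD ?add0n.
  have /count_memPn -> : k \notin D by rewrite kD.
  by rewrite big_ord_recl big_ord0 addr0.
rewrite !(bigD1_seq k) ?undup_uniq ?mem_undup //= eqxx big_ord_recr /= -!addrA.
congr (_ + _); rewrite addrC; congr (_ + _).
by apply: eq_bigr => j /negPf jk; rewrite eq_sym jk add0n.
Qed.

End Profile.

Section Invariants.

Variables (A : zmodType) (nf : seq A -> seq A).
Hypothesis nf_perm : forall C, exists t, perm_eq (nf C) (shift t C).
Hypothesis nf_eq : forall C D t, perm_eq D (shift t C) -> nf C = nf D.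
Implicit Types (C : seq A) (L : seq (seq A)).

Definition triangles C := [seq nf t | t <- subs 3 C].

(** For cells that are distinct modulo translation, the multiplicity of a class is the number of
    cells through one triangle of this class. *)
Definition all_triangles L := flatten [seq triangles C | C <- L].

(** A finer invariant than the multiplicities alone: a nonlinear [cube] applied cell by cell also
    records how they are distributed over the cells. *)
Definition triangle_sum (U : nmodType) (sq : nat -> U) (cube : U -> U) L : U :=
  \sum_(C <- L) cube (\sum_(k <- triangles C) sq (count_mem k (all_triangles L))).

Lemma nf_shift t C : nf (shift t C) = nf C.
Proof. by apply/esym; apply: (nf_eq (t := t)). Qed.

Lemma nf_permE C D : perm_eq C D -> nf C = nf D.
Proof.
move=> CD; apply: (nf_eq (t := 0)); rewrite perm_sym /shift.
by rewrite (eq_map (g := id)) ?map_id // => v; rewrite addr0.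
Qed.

Section Morphism.

Variable h : A -> A.
Hypotheses (hD : {morph h : a b / a + b}) (hB : bijective h).

(** An additive map sends translates to translates; this is its action on translation classes. *)
Let hn C := nf (map h C).

Lemma shift_morph t C : shift (h t) (map h C) = map h (shift t C).
Proof. by rewrite /shift -!map_comp; apply: eq_map => v /=; rewrite hD. Qed.

Lemma hn_nf C : hn (nf C) = hn C.
Proof.
have [t tC] := nf_perm C; apply/esym; apply: (nf_eq (t := h t)).
by rewrite shift_morph; apply: perm_map.
Qed.

Lemma hn_inj C D : hn C = hn D -> nf C = nf D.
Proof.
have [h' hK h'K] := hB.
rewrite /hn; have [s sC] := nf_perm (map h C); have [t tD] := nf_perm (map h D).
move=> CD; rewrite CD perm_sym in sC.
have := perm_trans sC tD.
rewrite -[s]h'K -[t]h'K !shift_morph => /(perm_map_inj (can_inj hK)) ps.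
by rewrite -(nf_shift (h' s) C) -(nf_shift (h' t) D); apply: nf_permE.
Qed.

Lemma triangles_morph C : perm_eq (triangles (hn C)) (map hn (triangles C)).
Proof.
rewrite /hn /triangles; have [t tC] := nf_perm (map h C).
apply: perm_trans (perm_subs 3 nf_permE tC) _.
rewrite /shift !subs_map -!map_comp.
suff -> : map (nf \o (map (fun v => v + t) \o map h)) (subs 3 C) =
          map (hn \o nf) (subs 3 C) by [].
by apply: eq_map => s /=; rewrite nf_shift hn_nf.
Qed.

Variables (L L' : seq (seq A)).
Hypothesis LL' : perm_eq L' (map hn L).

Let flatten_perm (T : eqType) (s s' : seq (seq T)) :
  perm_eq s s' -> perm_eq (flatten s) (flatten s').
Proof.
move=> ss'; apply/permP => a; rewrite !count_flatten !sumnE !big_map.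
exact: perm_big.
Qed.

Lemma all_triangles_morph :
  perm_eq (all_triangles L') (map hn (all_triangles L)).
Proof.
rewrite /all_triangles; apply: perm_trans (flatten_perm (perm_map _ LL')) _.
rewrite map_flatten -!map_comp; elim: L => //= C M IH.
exact: perm_cat (triangles_morph C) IH.
Qed.

Lemma all_triangles_nf k : k \in all_triangles L -> exists t, k = nf t.
Proof. by case/flatten_mapP => C _ /mapP[t _ ->]; exists t. Qed.

Lemma hn_inj_in : {in all_triangles L &, injective hn}.
Proof.
move=> _ _ /all_triangles_nf[s ->] /all_triangles_nf[t ->].
by rewrite !hn_nf; apply: hn_inj.
Qed.

Lemma profile_morph (U : zmodType) (W : nat -> U) :
  profile W (all_triangles L') = profile W (all_triangles L).
Proof.
by rewrite (profile_perm W all_triangles_morph) (profile_map _ hn_inj_in).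
Qed.

Lemma triangle_sum_morph (U : nmodType) (sq : nat -> U) cube :
  triangle_sum sq cube L' = triangle_sum sq cube L.
Proof.
rewrite /triangle_sum (perm_big _ LL') big_map big_seq [RHS]big_seq.
apply: eq_bigr => C CL; congr cube.
rewrite (perm_big _ (triangles_morph C)) big_map big_seq [RHS]big_seq.
apply: eq_bigr => k kC; congr sq; rewrite (permP all_triangles_morph).
apply: (count_map_inj_in hn_inj_in).
by apply/flatten_mapP; exists C.
Qed.

End Morphism.
End Invariants.

(** * Points of the lattice *)

(** A concrete copy of the lattice with binary coordinates, on which flips can be evaluated;
    [pt_int] identifies it with column vectors. *)
Record pt := Pt { px0 : Z; px1 : Z; px2 : Z; px3 : Z; px4 : Z }.

Definition pt_eqb (u v : pt) : bool :=
  let: Pt a b c d e := u in let: Pt a' b' c' d' e' := v in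
  [&& Z.eqb a a', Z.eqb b b', Z.eqb c c', Z.eqb d d' & Z.eqb e e'].

Lemma pt_eqP : Equality.axiom pt_eqb.
Proof.
move=> [a b c d e] [a' b' c' d' e'] /=.
apply: (iffP and5P) => [|[-> -> -> -> ->]]; last by rewrite !Z.eqb_refl.
by case=> /Z.eqb_eq -> /Z.eqb_eq -> /Z.eqb_eq -> /Z.eqb_eq -> /Z.eqb_eq ->.
Qed.

HB.instance Definition _ := hasDecEq.Build pt pt_eqP.
HB.instance Definition _ := gen_choiceMixin pt.

Definition pt_add (u v : pt) :=
  let: Pt a b c d e := u in let: Pt a' b' c' d' e' := v in
  Pt (Z.add a a') (Z.add b b') (Z.add c c') (Z.add d d') (Z.add e e').

Definition pt_opp (u : pt) :=
  let: Pt a b c d e := u in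
  Pt (Z.opp a) (Z.opp b) (Z.opp c) (Z.opp d) (Z.opp e).

Lemma pt_addA : associative pt_add.
Proof. by move=> [?????] [?????] [?????] /=; rewrite !Z.add_assoc. Qed.

Lemma pt_addC : commutative pt_add.
Proof. by move=> [?????] [?????] /=; congr Pt; apply: Z.add_comm. Qed.

Lemma pt_add0 : left_id (Pt 0 0 0 0 0)%coqZ pt_add.
Proof. by case. Qed.

Lemma pt_addN : left_inverse (Pt 0 0 0 0 0)%coqZ pt_opp pt_add.
Proof. by case=> *; rewrite /= !Z.add_opp_diag_l. Qed.

HB.instance Definition _ :=
  GRing.isZmodule.Build pt pt_addA pt_addC pt_add0 pt_addN.

Definition coords (u : pt) := let: Pt a b c d e := u in [:: a; b; c; d; e].

Fixpoint lexZ (s t : seq Z) : bool :=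
  match s, t with
  | a :: s', b :: t' =>
    match Z.compare a b with Lt => true | Gt => false | Eq => lexZ s' t' end
  | _, _ => true
  end.

Definition pt_le (u v : pt) := lexZ (coords u) (coords v).

Lemma pt_le_total : total pt_le.
Proof.
move=> u v; rewrite /pt_le; elim: (coords u) (coords v) => [|a s IH] [|b t] //=.
by rewrite (Z.compare_antisym a b); case: (Z.compare a b).
Qed.

Lemma lexZ_anti s t : size s = size t -> lexZ s t -> lexZ t s -> s = t.
Proof.
elim: s t => [|a s IH] [|b t] //= [st]; rewrite (Z.compare_antisym a b).
by case: (Z.compare_spec a b) => [->|_|_] //= h1 h2; rewrite (IH t).
Qed.

Lemma coords_inj : injective coords.
Proof. by move=> [?????] [?????] [-> -> -> -> ->]. Qed.

Lemma pt_le_anti : antisymmetric pt_le.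
Proof.
move=> u v /andP[uv vu]; apply: coords_inj; apply: lexZ_anti => //.
by case: u v {uv vu} => ????? [].
Qed.

Lemma pt_le_trans : transitive pt_le.
Proof.
move=> v u w; rewrite /pt_le.
have : size (coords u) = size (coords v) by case: u v => ????? [].
have : size (coords v) = size (coords w) by case: v w => ????? [].
elim: (coords u) (coords v) (coords w) => [|a s IH] [|b t] [|c r] //= [tr] [st].
case: (Z.compare_spec a b) => // ab; case: (Z.compare_spec b c) => // bc;
  case: (Z.compare_spec a c) => // ac; try lia.
exact: IH.
Qed.

Lemma pt_le_add w u v : pt_le (u + w) (v + w) = pt_le u v.
Proof.
case: u v w => a b c d e [a' b' c' d' e'] [x y z s t]; rewrite /pt_le /=.
have E p q r : Z.compare (p + r)%coqZ (q + r)%coqZ = Z.compare p q.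
  by case: (Z.compare_spec p q); case: Z.compare_spec => //; lia.
by rewrite !E.
Qed.

(** The order [pt_le] is invariant under translation, so sorting commutes with shifts; moving the
    least point to the origin then gives one list for all translates and orderings. *)
Definition nf (C : seq pt) : seq pt :=
  let s := sort pt_le C in let h := - head 0 s in [seq v + h | v <- s].

Lemma nf_perm C : exists t, perm_eq (nf C) (shift t C).
Proof.
exists (- head 0 (sort pt_le C)); rewrite /nf /shift; apply: perm_map.
by rewrite perm_sort.
Qed.

Lemma sort_shift C D t : perm_eq D (shift t C) ->
  sort pt_le D = shift t (sort pt_le C).
Proof.
move=> pD; apply: (sorted_eq pt_le_trans pt_le_anti).
- exact: sort_sorted pt_le_total _.
- rewrite /shift sorted_map (eq_sorted (e' := pt_le)); last first.
    by move=> u v /=; rewrite pt_le_add.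
  exact: sort_sorted pt_le_total _.
rewrite perm_sort (perm_trans pD) // /shift; apply: perm_map.
by rewrite perm_sym perm_sort.
Qed.

Lemma nf_eq C D t : perm_eq D (shift t C) -> nf C = nf D.
Proof.
move=> /sort_shift; rewrite /nf => ->; case: (sort pt_le C) => [//|v s] /=.
rewrite !subrr; congr (_ :: _); rewrite /shift -map_comp; apply: eq_map => u /=.
by rewrite opprD addrA addrAC addrK.
Qed.

Lemma nf_id C : nf (nf C) = nf C.
Proof. by have [t] := nf_perm C; move/nf_eq. Qed.

Lemma nf_sorted C : nf C = C -> sorted pt_le C.
Proof.
move=> <-; rewrite /nf sorted_map (eq_sorted (e' := pt_le)).
  exact: sort_sorted pt_le_total _.
by move=> u v /=; rewrite pt_le_add.
Qed.

(** The coordinates serve as base 5 digits. Being additive, [lin] allows differences to be taken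
    after encoding. *)
Definition lin (u : pt) : Z :=
  let: Pt a b c d e := u in
  (a + 5 * (b + 5 * (c + 5 * (d + 5 * e))))%coqZ.

(** Modulo translation a triangle is given by two edge vectors of five digits each, whence the
    factor 3125, the fifth power of 5. *)
Definition code (l : seq Z) : Z :=
  if l is [:: a; b; c] then ((b - a) + 3125 * (c - a))%coqZ else 0%coqZ.

Definition keys C := [seq code t | t <- subs 3 [seq lin u | u <- C]].

Definition allkeys (L : seq (seq pt)) := flatten [seq keys C | C <- L].

(** Base 5 expansions with digits from -2 to 2 are unique, so on small cells the integer keys
    identify the triangles. *)
Definition small_pt (u : pt) := all (fun c => Z.leb (Z.abs c) 2) (coords u).

Definition small (C : seq pt) := pairwise (fun u v => small_pt (v - u)) C.

Lemma linB u v : lin (u - v) = (lin u - lin v)%coqZ.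
Proof.
case: u v => a b c d e [a' b' c' d' e'].
have -> : Pt a b c d e - Pt a' b' c' d' e' =
  Pt (a + - a') (b + - b') (c + - c') (d + - d') (e + - e') by [].
by rewrite /lin; lia.
Qed.

Lemma subs_size (T : eqType) k (s t : seq T) : t \in subs k s -> size t = k.
Proof.
elim: s k t => [|x s IH] [|k] t //=; rewrite ?inE; try by move/eqP => ->.
by rewrite mem_cat => /orP[/mapP[t' /IH <- ->]|/IH].
Qed.

Lemma subs_subseq (T : eqType) k (s t : seq T) : t \in subs k s -> subseq t s.
Proof.
elim: s k t => [|x s IH] [|k] t //=; rewrite ?inE.
- by move/eqP => ->.
- by move/eqP => ->.
rewrite mem_cat => /orP[/mapP[t' /IH st ->]|/IH st]; first by rewrite /= eqxx.
exact: subseq_trans st (subseq_cons _ _).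
Qed.

Definition enc (k : seq pt) := code [seq lin u | u <- k].

(** A cell in normal form is sorted, hence so are its sublists, and normalising them only subtracts
    the first point. The keys can therefore be computed without sorting. *)
Lemma triangle_nf C t : nf C = C -> t \in subs 3 C ->
  exists a b c, t = [:: a; b; c] /\ nf t = [:: 0; b - a; c - a].
Proof.
move=> nC tC; have := subs_size tC; have sub := subs_subseq tC.
have st : sorted pt_le t.
  exact: (subseq_sorted pt_le_trans sub (nf_sorted nC)).
move: st; case: t tC sub => [|a [|b [|c []]]] // tC sub st _.
exists a, b, c; split=> //.
by rewrite /nf (sorted_sort pt_le_trans st) /= subrr.
Qed.

Lemma keys_enc C : nf C = C -> keys C = map enc (triangles nf C).
Proof.
move=> nC; rewrite /keys /triangles subs_map -!map_comp; apply/eq_in_map => t tC /=.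
have [a [b [c [-> ->]]]] := triangle_nf nC tC; rewrite /enc /map /code !linB.
by rewrite (_ : lin 0 = 0%coqZ) //; lia.
Qed.

Definition small_triangle (k : seq pt) :=
  exists u v, [/\ k = [:: 0; u; v], small_pt u & small_pt v].

Lemma triangles_small C : nf C = C -> small C ->
  {in triangles nf C, forall k, small_triangle k}.
Proof.
move=> nC sC k /mapP[t tC ->]; have [a [b [c [tE ->]]]] := triangle_nf nC tC.
exists (b - a), (c - a); have := subs_subseq tC; rewrite tE => sub.
have := subseq_pairwise sub sC; by rewrite /= !andbT => /andP[/andP[sb sc] _]; split.
Qed.

Lemma encE a b c d e f g h i j : enc [:: 0; Pt a b c d e; Pt f g h i j] =
  (a + 5 * (b + 5 * (c + 5 * (d + 5 * (e + 5 *
    (f + 5 * (g + 5 * (h + 5 * (i + 5 * j)))))))))%coqZ.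
Proof. by rewrite /enc /map /code (_ : lin 0 = 0%coqZ) // /lin; lia. Qed.

Lemma base5_inj a b x y : Z.leb (Z.abs a) 2 -> Z.leb (Z.abs b) 2 ->
  (a + 5 * x)%coqZ = (b + 5 * y)%coqZ -> a = b /\ x = y.
Proof. by lia. Qed.

Lemma enc_inj k k' : small_triangle k -> small_triangle k' ->
  enc k = enc k' -> k = k'.
Proof.
move=> [[a b c d e] [[f g h i j] [-> su sv]]].
move=> [[a' b' c' d' e'] [[f' g' h' i' j'] [-> su' sv']]].
move: su sv su' sv' => /and5P[? ? ? ? /andP[? _]] /and5P[? ? ? ? /andP[? _]].
move=> /and5P[? ? ? ? /andP[? _]] /and5P[? ? ? ? /andP[? _]].
rewrite !encE.
(* Nine digits are split off; what remains is the tenth. *)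
by do 9 (case/base5_inj => // ->); move=> ->.
Qed.

(** * Exploring a tree of flips *)

(* The second component is the profile of the tabulated list, which is updated
   along with the multiplicities. *)
Definition table := (PositiveMap.t nat * Z)%type.

(** The lowest bit holds the sign, and [xH] is left for 0. *)
Definition slot (k : Z) : positive :=
  match k with Z0 => xH | Zpos p => xO p | Zneg p => xI p end.

Definition lookup (t : table) k : nat := odflt 0%N (PositiveMap.find (slot k) t.1).

(* Arbitrary numbers: with generic weights, equal profiles mean that the
   multiplicities are equal up to order. *)
Definition weights : seq Z := [::
  466187829; 404632951; 515741193; 524072531; 480087571; 281743871; 449911241;
  350172963; 391821047; 503122319; 297381653; 421913377; 377719151; 530019283;
  322917259; 488817133; 271991837; 412319611; 361287919; 509903687; 303812447;
  453918761; 339912541; 521993419; 398821873; 287719027]%coqZ.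

(** Multiplicities past the end of the list get weight 0, which is as sound as any other value. *)
Definition weight (c : nat) : Z := nth 0%coqZ weights c.

Definition insert (t : table) k : table :=
  let c := lookup t k in
  (PositiveMap.add (slot k) c.+1 t.1, (t.2 + weight c)%coqZ).

Definition delete (t : table) k : table :=
  let c := (lookup t k).-1 in
  (PositiveMap.add (slot k) c t.1, (t.2 - weight c)%coqZ).

Definition empty_table : table := (PositiveMap.empty nat, 0%coqZ).

Definition tabulates (t : table) (D : seq Z) :=
  (forall k, lookup t k = count_mem k D) /\ t.2 = profile weight D.

Lemma slot_inj : injective slot.
Proof. by move=> [|p|p] [|q|q] //= [->]. Qed.

Lemma tabulates_empty : tabulates empty_table [::].
Proof.
split; last by rewrite /profile big_nil.
by move=> k; rewrite /lookup PositiveMap.gempty.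
Qed.

Lemma lookup_add t s k c j : lookup (PositiveMap.add (slot k) c t, s) j =
  if j == k then c else lookup (t, s) j.
Proof.
rewrite /lookup /=; case: eqP => [->|jk]; first by rewrite PositiveMap.gss.
by rewrite PositiveMap.gso // => /slot_inj.
Qed.

Lemma tabulates_insert t D k : tabulates t D -> tabulates (insert t k) (k :: D).
Proof.
case: t => t s [tD sD]; split; last by rewrite /insert tD profile_cons -sD.
move=> j; rewrite /insert lookup_add /= [k == j]eq_sym.
case: eqP => [->|_]; first by rewrite tD add1n.
by rewrite add0n -tD.
Qed.

Lemma tabulates_delete t D k : tabulates t (k :: D) -> tabulates (delete t k) D.
Proof.
case: t => t s [tD sD]; have tk := tD k; rewrite /= eqxx add1n in tk.
split; last first.
  rewrite /delete tk /=; rewrite /= in sD; rewrite sD profile_cons.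
  exact: addrK.
move=> j; rewrite /delete lookup_add tk /=.
by case: eqP => [->//|jk]; have := tD j; rewrite /= eq_sym (introF eqP jk).
Qed.

Lemma tabulates_perm t D D' : perm_eq D D' -> tabulates t D -> tabulates t D'.
Proof.
move=> DD' [tD sD]; split; last by rewrite sD (profile_perm _ DD').
by move=> k; rewrite tD; apply/permP.
Qed.

Lemma tabulates_inserts t D s : tabulates t D -> tabulates (foldl insert t s) (s ++ D).
Proof.
elim: s t D => //= k s IH t D /(tabulates_insert k) /IH; apply: tabulates_perm.
by rewrite -cat1s -(cat1s k (s ++ D)) !catA (perm_cat (permEl (perm_catC _ _))).
Qed.

Lemma tabulates_deletes t D s : tabulates t (s ++ D) -> tabulates (foldl delete t s) D.
Proof. by elim: s t => //= k s IH t /tabulates_delete /IH. Qed.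

Definition square (c : nat) : Z := (Z.of_nat c * Z.of_nat c)%coqZ.

Definition cube (c : Z) : Z := (c * c * c)%coqZ.

Definition key_sum (L : seq (seq pt)) : Z :=
  let t := foldl insert empty_table (allkeys L) in
  foldr Z.add 0%coqZ
    [seq cube (foldr Z.add 0%coqZ [seq square (lookup t k) | k <- keys C]) | C <- L].

Inductive flip_tree := Node of Z & seq flip_tree.

(** Stopping at 0 loses no coordinate, because the leading digit of each stored number is
    nonzero. *)
Fixpoint digits (fuel : nat) (n : Z) : seq Z :=
  if fuel is f.+1 then
    if n is Z0 then [::]
    else (Z.land n 15 - 8)%coqZ :: digits f (Z.shiftr n 4)
  else [::].

Fixpoint points (l : seq Z) : seq pt :=
  if l is [:: a, b, c, d, e & l'] then Pt a b c d e :: points l' else [::].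

(* A circuit is stored as the list of the coordinates of [Zp ++ Zm], in
   hexadecimal, each coordinate c being written as the digit c + 8, least
   significant digit first. *)
Definition decode (n : Z) : seq pt * seq pt :=
  let l := points (digits 100 n) in (take (size l)./2 l, drop (size l)./2 l).

Definition triangulation := (Z * seq (seq pt))%type.

(** The function [f] stays outside the inner fixpoint, so that [explore] can recurse through
    [gather] under the guard condition. A single failing branch makes the whole result [None]. *)
Definition gather (X Y : Type) (f : X -> option (seq Y)) (y : seq Y) :=
  fix gather (Ts : seq X) : option (seq Y) :=
    if Ts is T :: Ts' then
      if f T is Some r then omap (cat r) (gather Ts') else None
    else Some y.

Lemma gather_Forall (X Y : Type) (P : Y -> Prop) (f : X -> option (seq Y)) y Ts r :
    List.Forall P y ->
    (forall T s, List.In T Ts -> f T = Some s -> List.Forall P s) ->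
  gather f y Ts = Some r -> List.Forall P r.
Proof.
move=> Py; elim: Ts r => [|T Ts IH] r Pf /=; first by case=> <-.
case fT: (f T) => [s|//]; case gE: (gather f y Ts) => [r'|//] [<-].
apply/List.Forall_app; split; first by apply: Pf fT; left.
by apply: IH gE => T' s' TI; apply: Pf; right.
Qed.

(** The table is handed down the tree, so that a flip costs only the keys of the cells it changes.
    Smallness is tested on the new cells only; kept cells inherit it. *)
Fixpoint explore (T : flip_tree) (L : seq (seq pt)) (t : table) {struct T} :
    option (seq triangulation) :=
  let: Node n Ts := T in
  let: (Zp, Zm) := decode n in
  if flip nf Zp Zm L is Some (old, new, keep) then
    if all small new then
      let L' := new ++ keep in
      let t' := foldl delete (foldl insert t (allkeys new)) (allkeys old) in
      gather (fun T => explore T L' t') [:: (t'.2, L')] Ts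
    else None
  else None.

(* The profiles separate all but a few of the triangulations; the costlier
   [key_sum] is only computed for those. *)
Definition differ (a b : triangulation) : bool :=
  if Z.eqb a.1 b.1 then ~~ Z.eqb (key_sum a.2) (key_sum b.2) else true.

Section Correctness.

Variable R : realType.
Variable io : {additive pt -> 'cV[R]_5}.

Definition valid L := normal_cells io nf L /\ all small L.

Definition correct (T : triangulation) :=
  valid T.2 /\ T.1 = profile weight (all_triangles nf T.2).

Lemma allkeys_enc L : {in L, forall C, nf C = C} ->
  allkeys L = map enc (all_triangles nf L).
Proof.
move=> nL; rewrite /allkeys /all_triangles map_flatten -map_comp; congr flatten.
by apply/eq_in_map => C /nL /keys_enc.
Qed.

Lemma enc_inj_in L : {in L, forall C, nf C = C} -> all small L ->
  {in all_triangles nf L &, injective enc}.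
Proof.
move=> nL /allP sL.
have st k : k \in all_triangles nf L -> small_triangle k.
  by case/flatten_mapP => C CL; apply: triangles_small; [apply: nL|apply: sL].
by move=> k k' /st sk /st; apply: enc_inj.
Qed.

Lemma profile_keys L : valid L ->
  profile weight (allkeys L) = profile weight (all_triangles nf L).
Proof.
move=> [[_ nL] sL]; rewrite allkeys_enc //; apply: profile_map.
exact: enc_inj_in.
Qed.

Lemma key_sumE L : valid L -> key_sum L = triangle_sum nf square cube L.
Proof.
move=> [[_ nL] sL]; rewrite /key_sum.
have := tabulates_inserts (allkeys L) tabulates_empty; rewrite cats0.
set t := foldl _ _ _ => -[tE _].
rewrite foldrE big_map /triangle_sum big_seq [RHS]big_seq.
apply: eq_bigr => C CL; congr cube.
rewrite foldrE big_map keys_enc ?nL // big_map big_seq [RHS]big_seq.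
apply: eq_bigr => k kC; congr square; rewrite tE allkeys_enc //.
apply: (count_map_inj_in (enc_inj_in nL sL)).
by apply/flatten_mapP; exists C.
Qed.

Lemma allkeys_perm L L' : perm_eq L L' -> perm_eq (allkeys L) (allkeys L').
Proof.
move=> LL'; apply/permP => a; rewrite !count_flatten !sumnE !big_map.
exact: perm_big.
Qed.

Lemma flip_valid L Zp Zm old new keep : valid L ->
  flip nf Zp Zm L = Some (old, new, keep) -> all small new -> valid (new ++ keep).
Proof.
move=> [[[triL uL sL] nL] smL] fL sN.
have uC C : C \in L -> uniq C by case/sL.
split; [split; [split|]|].
- exact: (flip_triangulates nf_perm uC fL triL).
- exact: (flip_uniq fL uL).
- by apply: (flip_new_size nf_perm uC fL) => C /sL[].
- by move=> C /(flip_new_nf uC fL) [/nL//|[S ->]]; apply: nf_id.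
rewrite all_cat sN /=; have := flip_perm fL.
by move=> /perm_all pa; rewrite pa all_cat in smL; case/andP: smL.
Qed.

(** Subtrees sit inside a list, so an inner recursion has to supply the induction hypothesis for
    each of its members. *)
Fixpoint flip_tree_nested_ind (P : flip_tree -> Prop)
    (H : forall n Ts, (forall T, List.In T Ts -> P T) -> P (Node n Ts)) T : P T :=
  let: Node n Ts := T in
  H n Ts ((fix branches Ts : forall T, List.In T Ts -> P T :=
    match Ts with
    | [::] => fun T F => False_ind _ F
    | T0 :: Ts' => fun T TI => match TI with
        | or_introl e => match e with erefl => flip_tree_nested_ind H T0 end
        | or_intror i => branches Ts' T i end
    end) Ts).

Lemma explore_correct T L t r : valid L -> tabulates t (allkeys L) ->
  explore T L t = Some r -> List.Forall correct r.
Proof.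
move: T L t r.
elim/flip_tree_nested_ind.
move=> n Ts IH L t r vL tL.
rewrite /explore -/explore.

case: (decode n) => Zp Zm.
case fL: (flip nf Zp Zm L) => [[[old new] keep]|//]; case: ifP => // sN.
have vL' := flip_valid vL fL sN.
set t' := foldl delete _ _.
have tL' : tabulates t' (allkeys (new ++ keep)).
  apply: tabulates_deletes.
  (* Both sides count the keys of the old, new and kept cells once each. *)
  have pL : perm_eq (allkeys new ++ allkeys L) (allkeys old ++ allkeys (new ++ keep)).
    have := allkeys_perm (flip_perm fL); rewrite /allkeys !map_cat !flatten_cat.
    by move=> pL; rewrite perm_sym perm_catCA perm_cat2l perm_sym.
  exact: tabulates_perm pL (tabulates_inserts _ tL).
apply: gather_Forall => [|T s TI]; last exact: IH.
by constructor=> //; split=> //=; rewrite tL'.2 profile_keys.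
Qed.

End Correctness.

(** * Comparing triangulations in R^5 *)

Definition coord (i : nat) (v : pt) : Z := nth 0%coqZ (coords v) i.

Lemma coordB i u v : coord i (u - v) = (coord i u - coord i v)%coqZ.
Proof. by case: u v => ????? [?????]; case: i => [|[|[|[|[|[]]]]]]. Qed.

Definition pt_int (v : pt) : 'cV[int]_5 := \col_i int_of_Z (coord i v).

Definition int_pt (z : 'cV[int]_5) : pt :=
  let c i := Z_of_int (z (inord i) 0) in Pt (c 0%N) (c 1%N) (c 2%N) (c 3%N) (c 4%N).

Lemma pt_intK : cancel pt_int int_pt.
Proof.
by case=> a b c d e; rewrite /int_pt !mxE !inordK // /coord /= !int_of_ZK.
Qed.

Lemma int_ptK : cancel int_pt pt_int.
Proof.
move=> z; apply/matrixP => i j; rewrite mxE ord1.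
have -> : z i 0 = z (inord i) 0 by rewrite inord_val.
by case: i => -[|[|[|[|[|//]]]]] /= _; rewrite /coord /= Z_of_intK.
Qed.

Definition embed (R : realType) (v : pt) : 'cV[R]_5 := int_vec R (pt_int v).

Lemma embed_is_additive (R : realType) : zmod_morphism (@embed R).
Proof.
move=> u v; apply/matrixP => i j; rewrite !mxE coordB.
by rewrite -rmorphB /= -(rmorphB int_of_Z).
Qed.

HB.instance Definition _ (R : realType) :=
  GRing.isZmodMorphism.Build pt 'cV[R]_5 (@embed R) (@embed_is_additive R).

Section Comparison.

Variable R : realType.
Local Notation io := (@embed R).

Lemma embedE v : embed R v = int_vec R (pt_int v).
Proof. by []. Qed.

(** An equivalence carries both statistics over, so a difference in either one excludes it. *)
Lemma differ_correct a b : correct io a -> correct io b -> differ a b ->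
  ~ gl_equivalent (cells_of io a.2) (cells_of io b.2).
Proof.
move=> [va aE] [vb bE] ab gab; have [na _] := va; have [nb _] := vb.
have [h [hD hB pab]] :=
  gl_equivalent_cells pt_intK int_ptK embedE nf_perm nf_eq na nb gab.
have e1 : a.1 = b.1.
  by rewrite aE bE (profile_morph nf_perm nf_eq hD hB pab).
have e2 : key_sum a.2 = key_sum b.2.
  rewrite (key_sumE va) (key_sumE vb).
  by rewrite (triangle_sum_morph nf_perm nf_eq hD hB pab).
by move: ab; rewrite /differ e1 e2 !Z.eqb_refl.
Qed.

Lemma differC a b : differ a b = differ b a.
Proof. by rewrite /differ Z.eqb_sym; case: ifP => // _; rewrite Z.eqb_sym. Qed.

End Comparison.

(** * Kuhn's triangulation *)

Definition unit_pt (i : nat) : pt :=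
  nth 0 [:: Pt 1 0 0 0 0; Pt 0 1 0 0 0; Pt 0 0 1 0 0; Pt 0 0 0 1 0; Pt 0 0 0 0 1]%coqZ i.

(** The vertices of the simplex [1 >= x_(p_0) >= ... >= x_(p_4) >= 0]. *)
Definition chain (p : seq nat) : seq pt := 0 :: scanl (fun v i => v + unit_pt i) 0 p.

Definition perms := permutations (iota 0 5).

Definition kuhn : seq (seq pt) := [seq chain p | p <- perms].

(* The k-th barycentric coordinate on [chain p]; the index 5 stands for a
   coordinate that is constantly 0. *)
Definition bary (p : seq nat) k (v : pt) : Z :=
  (Z.b2z (k == 0%N) + coord (nth 5%N (5%N :: p) k) v - coord (nth 5%N p k) v)%coqZ.

Definition difference i j v : Z := (coord i v - coord j v)%coqZ.

Definition bary_dual p :=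
  all (fun k => all (fun j => Z.eqb (bary p k (nth 0 (chain p) j)) (Z.b2z (k == j)))
    (iota 0 6)) (iota 0 6).

(* Each coordinate difference takes only two consecutive values on a cell. *)
Definition narrow C := all (fun i => all (fun j =>
    all (fun v => let d := difference i j v in Z.leb 0 d && Z.leb d 1) C ||
    all (fun v => let d := difference i j v in Z.leb (-1) d && Z.leb d 0) C)
  (iota 0 6)) (iota 0 6).

Definition in_cube p :=
  let B := [:: 0; 1]%coqZ in
  all (fun a => all (fun b => all (fun c => all (fun d => all (fun e =>
    let u := Pt a b c d e in
    all (fun k => Z.leb 0 (bary p k u)) (iota 0 6) ==> (u \in chain p)) B) B) B) B) B.

Lemma kuhn_checks :
  all (fun p => [&& bary_dual p, narrow (chain p) & in_cube p]) perms.
Proof. by vm_compute. Qed.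

Lemma permsP p : (p \in perms) = perm_eq p (iota 0 5).
Proof. exact: mem_permutations. Qed.

Lemma perms_size p : p \in perms -> size p = 5.
Proof. by rewrite permsP => /perm_size. Qed.

Lemma chain_size p : p \in perms -> size (chain p) = 6.
Proof. by move=> /perms_size sp; rewrite /= size_scanl sp. Qed.

Lemma bary_chain p k j : p \in perms -> (k < 6)%N -> (j < 6)%N ->
  bary p k (nth 0 (chain p) j) = Z.b2z (k == j).
Proof.
move=> /(allP kuhn_checks)/and3P[/allP dual _ _] k6 j6.
have /dual/allP dualk : k \in iota 0 6 by rewrite mem_iota.
by have /dualk/Z.eqb_eq : j \in iota 0 6 by rewrite mem_iota.
Qed.

Lemma chain_uniq p : p \in perms -> uniq (chain p).
Proof.
move=> pP; apply/(uniqP 0) => i j; rewrite !inE chain_size // => i6 j6 ij.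
have := bary_chain pP i6 i6; rewrite ij bary_chain // eqxx.
by case: eqP.
Qed.

Lemma chain_narrow p i j u v : p \in perms -> (i < 6)%N -> (j < 6)%N ->
  u \in chain p -> v \in chain p -> Z.le (difference i j u) (difference i j v + 1).
Proof.
move=> /(allP kuhn_checks)/and3P[_ /allP nar _] i6 j6 uC vC.
have /nar/allP nari : i \in iota 0 6 by rewrite mem_iota.
have /nari/orP narij : j \in iota 0 6 by rewrite mem_iota.
by case: narij => /allP h; move: (h u uC) (h v vC) => /= /andP[? ?] /andP[? ?]; lia.
Qed.

(** The inequalities say [1 >= u_(p_0) >= ... >= u_(p_4) >= 0], so the integer coordinates of [u]
    are 0 or 1, and [in_cube] has settled these 32 points. *)
Lemma bary_mem p u : p \in perms ->
  (forall k, (k < 6)%N -> Z.le 0 (bary p k u)) -> u \in chain p.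
Proof.
move=> pP b0; have := allP kuhn_checks p pP => /and3P[_ _ cube].
have sp := perms_size pP; rewrite permsP in pP.
have co i : i \in p -> coord i u = 0%coqZ \/ coord i u = 1%coqZ.
  case: p sp {pP cube} b0 => [|a [|b [|c [|d [|e []]]]]] // _ b0.
  have c5 : coord 5 u = 0%coqZ by case: (u).
  have h0 : Z.le 0 (1 + coord 5 u - coord a u)%coqZ := b0 0%N isT.
  have h1 : Z.le 0 (0 + coord a u - coord b u)%coqZ := b0 1%N isT.
  have h2 : Z.le 0 (0 + coord b u - coord c u)%coqZ := b0 2%N isT.
  have h3 : Z.le 0 (0 + coord c u - coord d u)%coqZ := b0 3%N isT.
  have h4 : Z.le 0 (0 + coord d u - coord e u)%coqZ := b0 4%N isT.
  have h5 : Z.le 0 (0 + coord e u - coord 5 u)%coqZ := b0 5%N isT.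
  rewrite c5 in h0 h5.
  by rewrite !inE => /or4P[|||/orP[]] /eqP ->; clear -h0 h1 h2 h3 h4 h5; lia.
have {}co i : (i < 5)%N -> coord i u \in [:: 0; 1]%coqZ.
  move=> i5; have : i \in p by rewrite (perm_mem pP) mem_iota.
  by move/co => [->|->].
move: (co 0%N isT) (co 1%N isT) (co 2%N isT) (co 3%N isT) (co 4%N isT) => {co}.
case: u b0 => a b c d e b0; rewrite /coord /= => h0 h1 h2 h3 h4.
move: cube => /allP/(_ a h0)/allP/(_ b h1)/allP/(_ c h2)/allP/(_ d h3)/allP/(_ e h4).
move=> /implyP; apply; apply/allP => k; rewrite mem_iota => k6.
by apply/Z.leb_le; apply: b0.
Qed.

Section Kuhn.

Variable R : realType.
Local Notation io := (@embed R).

Definition zR (z : Z) : R := (int_of_Z z)%:~R.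

Lemma zRD a b : zR (a + b)%coqZ = zR a + zR b.
Proof. by rewrite /zR (rmorphD int_of_Z) rmorphD. Qed.

Lemma zRN a : zR (- a)%coqZ = - zR a.
Proof. by rewrite /zR (rmorphN int_of_Z) rmorphN. Qed.

Lemma zR_ge0 a : (0 <= zR a) = Z.leb 0 a.
Proof. by rewrite /zR ler0z; case: a. Qed.

Definition coordR i (x : 'cV[R]_5) : R := if insub i is Some k then x k 0 else 0.

Lemma coordR_embed i v : coordR i (io v) = zR (coord i v).
Proof.
rewrite /coordR; case: insubP => [k _ <-|]; first by rewrite !mxE.
rewrite -leqNgt => i5; rewrite /coord nth_default //.
by case: v.
Qed.

Lemma coordR_sum i (T : Type) (r : seq T) (F : T -> 'cV[R]_5) :
  coordR i (\sum_(k <- r) F k) = \sum_(k <- r) coordR i (F k).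
Proof.
rewrite /coordR; case: insubP => [k _ _|_]; last by rewrite big1.
by rewrite summxE.
Qed.

Lemma coordRZ i (a : R) x : coordR i (a *: x) = a * coordR i x.
Proof. by rewrite /coordR; case: insubP => [k _ _|_]; rewrite ?mxE ?mulr0. Qed.

(** A barycentric coordinate is an affine function, so its weighted mean is its value at [x],
    whichever cell represents [x]. *)
Lemma rep_bary p k t Y m x : rep io Y m x ->
  \sum_(v <- Y) m v * zR (bary p k (v - t)) =
  zR (Z.b2z (k == 0%N) - difference (nth 5%N (5%N :: p) k) (nth 5%N p k) t)%coqZ
    + coordR (nth 5 (5 :: p) k) x - coordR (nth 5 p k) x.
Proof.
move=> [_ _ m1 ->]; set i := nth _ _ _; set j := nth _ _ _; set c := (_ - _)%coqZ.
have bE v : zR (bary p k (v - t)) = zR c + coordR i (io v) - coordR j (io v).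
  rewrite !coordR_embed -zRD -zRN -zRD; congr zR.
  by rewrite /bary !coordB /c /difference -/i -/j; lia.
rewrite !coordR_sum -[zR c]mulr1 -m1 mulr_sumr -big_split /= -sumrB.
by apply: eq_bigr => v _; rewrite bE !coordRZ; ring.
Qed.

Lemma chain_bary_sum p k t Y (w : pt -> R) : p \in perms -> (k < 6)%N ->
    uniq Y -> Y =i shift t (chain p) ->
  \sum_(v <- Y) w v * zR (bary p k (v - t)) = w (nth 0 (chain p) k + t).
Proof.
move=> pP k6 uY YE.
have uC := chain_uniq pP; have sC := chain_size pP.
rewrite (perm_big (shift t (chain p))); last by apply: uniq_perm; rewrite ?shift_uniq.
rewrite big_map (big_nth 0) big_mkord sC (bigD1 (Ordinal k6)) //= addrK bary_chain //.
rewrite eqxx mulr1 big1 ?addr0 // => j jk; rewrite addrK bary_chain //.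
have /negPf -> : k != j by rewrite eq_sym.
by rewrite mulr0.
Qed.

(** Up to a constant, [bary p k] is a difference of two coordinates, and such a difference varies by
    at most 1 on a cell of Kuhn's triangulation. Hence no cell has values on both sides of 0. *)
Lemma bary_narrow p q k t s (Y : seq pt) u v : p \in perms -> q \in perms -> (k < 6)%N ->
    Y =i shift s (chain q) -> u \in Y -> v \in Y ->
  Z.le (bary p k (u - t)) (bary p k (v - t) + 1).
Proof.
move=> pP qP k6 YE; rewrite !YE !mem_shift => uC vC.
have lt6 i : (i < 6)%N -> (nth 5%N p i < 6)%N.
  move=> i6; case: (ltnP i 5) => i5; last by rewrite nth_default ?perms_size.
  have : nth 5%N p i \in iota 0 5.
    by rewrite -(perm_mem (_ : perm_eq p _)) -?permsP // mem_nth ?perms_size.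
  by rewrite mem_iota => /andP[_ h]; apply: ltnW.
have i6 : (nth 5%N (5%N :: p) k < 6)%N by case: k k6 => //= k /ltnW /lt6.
have := chain_narrow qP i6 (lt6 k k6) uC vC.
by rewrite /difference /bary !coordB; clear; lia.
Qed.

Lemma rep_support Y Y' m x : uniq Y -> uniq Y' -> rep io Y m x ->
  (forall v, v \notin Y' -> m v = 0) -> rep io Y' m x.
Proof.
move=> uY uY' r m0; have [mge0 _ _ _] := r.
apply: (rep_balanced (Z := [::]) (f := fun=> 0) (a := 0)) r _ _ _ => //.
- by move=> W _ _; split; apply: big1 => // v _; rewrite scale0r.
- by move=> v; rewrite mulr0 addr0.
Qed.

(** The mean of [f k] under [m2] is a weight of [m1], hence nonnegative. If [f k] were negative at a
    point charged by [m2], it would be at most 0 on all of [Y2] and its mean negative. So by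
    [bary_mem] all points charged by [m2] are vertices of [Y1], where the barycentric coordinates
    determine the weights. *)
Lemma kuhn_unique Y1 Y2 m1 m2 x : cell kuhn Y1 -> cell kuhn Y2 ->
  rep io Y1 m1 x -> rep io Y2 m2 x -> m1 =1 m2.
Proof.
move=> [_ [t1 [/mapP[p1 pP1 ->] u1 E1]]] [_ [t2 [/mapP[p2 pP2 ->] u2 E2]]] r1 r2.
have [m1_ge0 m1_out _ _] := r1; have [m2_ge0 m2_out _ _] := r2.
pose f k v := bary p1 k (v - t1).
have f1 k : (k < 6)%N ->
    m1 (nth 0 (chain p1) k + t1) = \sum_(v <- Y2) m2 v * zR (f k v).
  move=> k6; rewrite -(chain_bary_sum m1 pP1 k6 u1 E1).
  by rewrite (rep_bary p1 k t1 r1) (rep_bary p1 k t1 r2).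
have f_ge0 k v : (k < 6)%N -> v \in Y2 -> 0 < m2 v -> Z.le 0 (f k v).
  move=> k6 vY mv; case: (Z.le_gt_cases 0 (f k v)) => // fv.
  have : 0 <= \sum_(v <- Y2) m2 v * zR (f k v) by rewrite -f1.
  rewrite (bigD1_seq v) //= leNgt => /negP[].
  have fvR : zR (f k v) < 0.
    by rewrite ltNge zR_ge0; apply/negP => /Z.leb_le; lia.
  rewrite -[X in _ < X]addr0; apply: ltr_leD; first by rewrite pmulr_rlt0.
  rewrite big_seq_cond; apply: sumr_le0 => u /andP[uY _].
  apply: mulr_ge0_le0 => //; rewrite -oppr_ge0 -zRN zR_ge0; apply/Z.leb_le.
  by have := bary_narrow (t := t1) pP1 pP2 k6 E2 uY vY; rewrite -/(f k u) -/(f k v); lia.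
have m2_out1 v : v \notin Y1 -> m2 v = 0.
  move=> vY1; apply/eqP; rewrite eq_le m2_ge0 andbT leNgt; apply/negP => mv.
  have vY2 : v \in Y2 by apply: contraLR mv => /m2_out ->; rewrite ltxx.
  move: vY1; rewrite E1 mem_shift => /negP[].
  by apply: bary_mem => // k k6; apply: f_ge0.
have r2' := rep_support u2 u1 r2 m2_out1.
move=> v; case: (boolP (v \in Y1)) => vY1; last by rewrite m1_out ?m2_out1.
have vC : v - t1 \in chain p1 by rewrite -mem_shift -E1.
have k6 : (index (v - t1)%R (chain p1) < 6)%N by move: vC; rewrite -index_mem chain_size.
rewrite -(subrK t1 v) -(nth_index 0 vC) -!(chain_bary_sum _ pP1 k6 u1 E1).
by rewrite (rep_bary p1 _ t1 r1) (rep_bary p1 _ t1 r2').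
Qed.

Lemma coord_unit k i : (i < 5)%N -> zR (coord i (unit_pt k)) = (k == i)%:R.
Proof.
case: k => [|[|[|[|[|k]]]]]; case: i => [|[|[|[|[|i]]]]] // _.
all: by rewrite /unit_pt nth_default.
Qed.

(** Sorting the fractional parts of [x] in decreasing order gives the permutation, and their
    successive differences are the weights. *)
Lemma kuhn_cover x : exists Y m, cell kuhn Y /\ rep io Y m x.
Proof.
pose t := int_pt (\col_i Num.floor (x i 0)).
pose y i := coordR i x - zR (coord i t).
have yP i : (i < 5)%N -> 0 <= y i <= 1.
  move=> i5; rewrite /y /coordR insubT /=.
  have -> : zR (coord i t) = (Num.floor (x (Ordinal i5) 0))%:~R.
    have /matrixP/(_ (Ordinal i5) 0) := int_ptK (\col_i Num.floor (x i 0)).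
    by rewrite !mxE /zR => ->.
  have := floor_itv (x (Ordinal i5) 0); rewrite rmorphD /=.
  by move=> /andP[h1 h2]; apply/andP; split; lra.
pose ge i j := y j <= y i.
pose p := sort ge (iota 0 5).
have pP : p \in perms by rewrite permsP perm_sort.
have sp : sorted ge p by apply: sort_sorted => i j; apply: le_total.
have sC := chain_size pP; have uC := chain_uniq pP.
exists (shift t (chain p)).
suff : geo io (shift t (chain p)) x.
  move=> [m r]; exists m; split=> //; exists (chain p), t; split=> //.
    by apply: map_f.
  by rewrite shift_uniq.
have uS : uniq (shift t (chain p)) by rewrite shift_uniq.
have sS : size (shift t (chain p)) = 6 by rewrite size_map.
rewrite -(hull_geoT io uS sS).
have szp := perms_size pP.
have sumy (F : nat -> 'cV[R]_5) : \sum_(i <- p) F i = \sum_(i <- iota 0 5) F i.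
  by apply: perm_big; rewrite -permsP.
have pin i : i \in p -> (i < 5)%N.
  by move: pP; rewrite permsP => /perm_mem ->; rewrite mem_iota.
move: sp sumy pin szp; rewrite /vertices; move: (p) => {sC uC uS sS pP p} p.
case: p => [|a [|b [|c [|d [|e []]]]]] //= /and5P[ab bc cd de _] sumy pin _.
have ya : 0 <= y a <= 1 by apply/yP/pin; rewrite !inE eqxx.
have ye : 0 <= y e <= 1 by apply/yP/pin; rewrite !inE eqxx !orbT.
rewrite /ge in ab bc cd de; move: ya ye => /andP[_ ya1] /andP[ye0 _].
pose w := [:: 1 - y a; y a - y b; y b - y c; y c - y d; y d - y e; y e].
exists (fun i => nth 0 w i); split.
- by case=> -[|[|[|[|[|[|j]]]]]] i6 //; rewrite /w /= ?subr_ge0.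
- by rewrite !big_ord_recl big_ord0 /=; ring.
rewrite !big_ord_recl big_ord0 /= !raddfD raddf0 /=.
have := sumy (fun i => y i *: io (unit_pt i)); rewrite !big_cons !big_nil.
set Ea := io (unit_pt a); set Eb := io (unit_pt b); set Ec := io (unit_pt c).
set Ed := io (unit_pt d); set Ee := io (unit_pt e) => sumE.
(* Summation by parts: the weights of the vertices involving the unit vector of index [i] add up to
   [y i]. *)
transitivity (io t +
    (y a *: Ea + (y b *: Eb + (y c *: Ec + (y d *: Ed + (y e *: Ee + 0)))))).
  rewrite sumE; apply/matrixP => i j; rewrite ord1.
  have ioE v : io v i 0 = zR (coord i v) by rewrite !mxE.
  have yE : y i = x i 0 - zR (coord i t) by rewrite /y /coordR valK.
  have unitE k : io (unit_pt k) i 0 = (k == i :> nat)%:R.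
    by rewrite ioE coord_unit.
  have addE (u v : 'cV[R]_5) : (u + v) i 0 = u i 0 + v i 0 by rewrite mxE.
  have scaleE (r : R) (v : 'cV[R]_5) : (r *: v) i 0 = r * v i 0 by rewrite mxE.
  have zeroE : (0 : 'cV[R]_5) i 0 = 0 by rewrite mxE.
  rewrite !addE !scaleE zeroE !unitE ioE -[X in X = _](subrK (zR (coord i t))) -yE addrC.
  congr (_ + _); case: i {ioE yE unitE addE scaleE zeroE} => -[|[|[|[|[|i]]]]] i5 //=;
    by rewrite ?(mulr1, mulr0, addr0, add0r).
apply/matrixP => i j; rewrite !mxE /y; ring.
Qed.

Lemma kuhn_triangulates : triangulates io kuhn.
Proof. split; [exact: kuhn_cover|exact: kuhn_unique]. Qed.

Lemma kuhn_valid : valid io kuhn.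
Proof.
have /and3P[uK /allP nK sK] :
    [&& uniq kuhn, all (fun C => nf C == C) kuhn & all small kuhn].
  by vm_compute.
have sizeK C : C \in kuhn -> uniq C /\ size C = 6.
  by case/mapP=> [p pP ->]; split; [apply: chain_uniq|apply: chain_size].
have nfK : {in kuhn, forall C, nf C = C} by move=> C /nK /eqP.
exact (conj (conj (And3 kuhn_triangulates uK sizeK) nfK) sK).
Qed.

End Kuhn.

(** * The 950 triangulations *)

(* A spanning tree, found by computer search, of the graph whose vertices are the
   equivalence classes reachable from Kuhn's triangulation and whose edges are
   the flips. *)
Definition flips : seq flip_tree := (
  [:: Node 0x89999888889999978888 [:: Node 0x89989888889999978878 [:: Node
  0x88999888889899978888 [:: Node 0x999898898988888999999898978878 [:: Node
  0x999899988888888a99998988888878 [:: Node 0x88989888889999977878 [::]; Node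
  0x88989888888888988988 [:: Node 0xa99a98989888888998999999888898 [:: Node
  0xa89999898988888989999888998988 [:: Node 0xa99a99989888888998999999898898
  [:: Node 0xa99a9a899988888a99999889998998 [:: Node
  0xa99a99899988888999999889998998 [:: Node 0xa99999898988888999999888998988
  [:: Node 0xa89999889888888988999899898888 [:: Node
  0xa99999989888888998999999898888 [::]]]; Node
  0xa89999889888888988999899898888 [::]]]]; Node
  0xa99a9a899988888a99999889998998 [:: Node 0xa99a99899988888999999889998998
  [:: Node 0xa99999898988888999999888998988 [::]]; Node
  0xa89999889888888988999899898888 [:: Node 0xa899988888a999987888 [:: Node
  0xa99a99989888888998999999898898 [:: Node 0x888998878988888998998888977788
  [:: Node 0xa99999989888888998999999898888 [::]]; Node
  0x888998899888888999998889877888 [::]; Node 0xa99a99899988888999999889998998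
  [:: Node 0xa99999898988888999999888998988 [:: Node
  0xa99999989888888998999999898888 [::]]]; Node
  0xa99999989888888998999999898888 [::]]; Node
  0x888998878988888998998888977788 [:: Node 0x888998899888888999998889877888
  [:: Node 0x88789888889989977778 [::]]]]; Node 0xa8999888889899998888 [::
  Node 0xa99a99989888888998999999898898 [:: Node
  0xa99a99899988888999999889998998 [:: Node 0xa99999898988888999999888998988
  [:: Node 0xa99999989888888998999999898888 [::]]; Node 0xa99a9888889999998898
  [:: Node 0xa99999898988888999999888998988 [::]]]; Node
  0xa99999989888888998999999898888 [::]]]; Node 0xa8999888889888998998 [::
  Node 0xa99a99989888888998999999898898 [:: Node
  0xa99a99899988888999999889998998 [:: Node 0xa99999898988888999999888998988
  [::]]; Node 0xa99999989888888998999999898888 [:: Node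
  0xa99999988888888998899999898888 [::]]]]]]]; Node
  0xa99a9a899988888a99999889998998 [::]]]; Node 0x88989888889899978878 [::]]];
  Node 0x89899888889999978788 [:: Node 0x998999988888888a99998988888788 [::
  Node 0x999898898988888999999898978878 [:: Node
  0x999899988888888a99998988888878 [:: Node 0x998998889988888999999889978788
  [::]]]; Node 0x999899988888888a99998988888878 [::]; Node
  0x998998889988888999999889978788 [:: Node 0x88899888888888988898 [:: Node
  0xa9a99a899988888a99999898998998 [:: Node 0xa9a999899988888999999898998998
  [:: Node 0x999898898988888999999898978878 [:: Node
  0xa9a998998888888999899999888988 [:: Node 0xa9a999998888888999899999898988
  [:: Node 0x999899988888888a99998988888878 [::]]]; Node
  0x999899988888888a99998988888878 [::]; Node 0xa89999898888888989899899898888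
  [::]]; Node 0xa9a998998888888999899999888988 [:: Node
  0xa9a999998888888999899999898988 [::]; Node 0x999899988888888a99998988888878
  [::]]; Node 0x999899988888888a99998988888878 [::]; Node
  0xa89999898888888989899899898888 [::]]; Node
  0xa9a998998888888999899999888988 [::]; Node 0x999898898988888999999898978878
  [:: Node 0x999899988888888a99998988888878 [::]]; Node
  0x999899988888888a99998988888878 [::]; Node 0xa89999898888888989899899898888
  [::]]; Node 0x999898898988888999999898978878 [:: Node
  0x999899988888888a99998988888878 [:: Node 0x88989888889999977878 [:: Node
  0xa9a99a899988888a99999898998998 [:: Node 0xa9a999899988888999999898998998
  [:: Node 0xa9a998998888888999899999888988 [:: Node
  0xa9a999998888888999899999898988 [:: Node 0xa9a99888889898999998 [::]; Node
  0xa9a99888889998998998 [::]; Node 0xa9a99888889999998988 [::]]]]; Node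
  0xa9a998998888888999899999888988 [::]]]; Node 0x88989888888888988988 [::
  Node 0xa9a99a899988888a99999898998998 [:: Node
  0xa9a999899988888999999898998998 [:: Node 0xa99a98989888888998999999888898
  [:: Node 0xa99a99989888888998999999898898 [::]; Node
  0xa9a998998888888999899999888988 [::]; Node 0xa99a9a899988888a99999889998998
  [::]]; Node 0xa9a998998888888999899999888988 [:: Node
  0xa99a9a899988888a99999889998998 [::]; Node 0xa9a999998888888999899999898988
  [::]]; Node 0xa99a9a899988888a99999889998998 [:: Node
  0xa99a99899988888999999889998998 [::]]]; Node
  0xa99a98989888888998999999888898 [:: Node 0xa9a998998888888999899999888988
  [:: Node 0xa99a9a899988888a99999889998998 [::]]]; Node
  0xa9a998998888888999899999888988 [::]; Node 0xa99a9a899988888a99999889998998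
  [::]]]; Node 0x88989888889898978888 [:: Node
  0xa9a99a899988888a99999898998998 [:: Node 0xa9a999899988888999999898998998
  [:: Node 0xa9a998998888888999899999888988 [:: Node
  0xa9a999998888888999899999898988 [::]]]; Node
  0xa9a998998888888999899999888988 [::]]]; Node 0x88989888889899978878 [::
  Node 0xa9a99a899988888a99999898998998 [:: Node
  0xa9a999899988888999999898998998 [:: Node 0xa9a998998888888999899999888988
  [:: Node 0xa9a999998888888999899999898988 [:: Node 0xa9a99888889998998998
  [::]]]]; Node 0xa9a998998888888999899999888988 [::]]]]]]; Node
  0x88899888889889978888 [:: Node 0x999898898988888999999898978878 [:: Node
  0x999899988888888a99998988888878 [:: Node 0x88989888889999977878 [::]; Node
  0x88989888889898978888 [::]; Node 0x88989888889899978878 [::]]]]; Node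
  0x88899888889899978788 [:: Node 0x999898898988888999999898978878 [:: Node
  0x999899988888888a99998988888878 [:: Node 0x88989888889999977878 [::]; Node
  0x88989888889899978878 [::]]]]; Node 0x88899888889999977788 [:: Node
  0x999898898988888999999898978878 [:: Node 0x999899988888888a99998988888878
  [:: Node 0x88989888889999977878 [::]]]]]]; Node 0x89998888889999978887 [::
  Node 0x999988899888888999999899878887 [:: Node
  0x998999988888888a99998988888788 [:: Node 0x999898898988888999999898978878
  [:: Node 0x999899988888888a99998988888878 [:: Node
  0x999989988888888a99998988888887 [:: Node 0x998998889988888999999889978788
  [::]]]; Node 0x998998889988888999999889978788 [::]]; Node
  0x999989988888888a99998988888887 [:: Node 0x998998889988888999999889978788
  [::]]]; Node 0x999898898988888999999898978878 [:: Node
  0x998998889988888999999889978788 [::]]; Node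
  0x999989988888888a99998988888887 [:: Node 0x88998888889999977887 [:: Node
  0x998999988888888a99998988888788 [:: Node 0x999898898988888999999898978878
  [:: Node 0x999899988888888a99998988888878 [:: Node
  0x998998889988888999999889978788 [::]]]; Node
  0x999899988888888a99998988888878 [::]; Node 0x998998889988888999999889978788
  [:: Node 0x88899888888888988898 [:: Node 0xa9a99a899988888a99999898998998
  [:: Node 0xa9a999899988888999999898998998 [:: Node
  0x999889888888888a99998887888887 [:: Node 0xa9a998998888888999899999888988
  [:: Node 0x999898898988888999999898978878 [:: Node
  0xa9a999998888888999899999898988 [:: Node 0x999899988888888a99998988888878
  [:: Node 0x99988998888888888888a9999898888887888887 [::]; Node
  0x999888998888888999899999878877 [:: Node
  0x9998899988889888888899989999989898878877 [:: Node
  0x99988998888888888888a9999898888887888887 [:: Node 0x99888888889988988887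
  [::]; Node 0x99888888889989888878 [::]; Node 0x99988888889999888878 [::];
  Node 0x99988888889898889888 [::]]]]]; Node 0x999888998888888999899999878877
  [:: Node 0x9998899988889888888899989999989898878877 [::]]]; Node
  0x999899988888888a99998988888878 [:: Node
  0x99988998888888888888a9999898888887888887 [::]]]; Node
  0xa9a999998888888999899999898988 [:: Node 0x999899988888888a99998988888878
  [:: Node 0x99988998888888888888a9999898888887888887 [::]]; Node
  0x999888998888888999899999878877 [::]]; Node
  0x999899988888888a99998988888878 [:: Node
  0x99988998888888888888a9999898888887888887 [::]]]; Node
  0x999898898988888999999898978878 [:: Node 0x999899988888888a99998988888878
  [:: Node 0x99988998888888888888a9999898888887888887 [::]]]; Node
  0x999899988888888a99998988888878 [:: Node
  0x99988998888888888888a9999898888887888887 [::]]]; Node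
  0xa9a998998888888999899999888988 [:: Node 0x999898898988888999999898978878
  [:: Node 0xa9a999998888888999899999898988 [:: Node
  0x999899988888888a99998988888878 [::]]; Node
  0x999899988888888a99998988888878 [:: Node 0x999888998888888999899999878877
  [::]]; Node 0x999888998888888999899999878877 [::]]; Node
  0xa9a999998888888999899999898988 [:: Node 0xa9a99888889998998998 [:: Node
  0x999889888888888a99998887888887 [:: Node 0x999898898988888999999898978878
  [:: Node 0x999899988888888a99998988888878 [:: Node
  0x99988998888888888888a9999898888887888887 [::]; Node
  0x999888998888888999899999878877 [:: Node
  0x9998899988889888888899989999989898878877 [:: Node
  0x99988998888888888888a9999898888887888887 [::]]]]; Node
  0x999888998888888999899999878877 [:: Node
  0x9998899988889888888899989999989898878877 [::]]]; Node
  0x999899988888888a99998988888878 [:: Node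
  0x99988998888888888888a9999898888887888887 [::]]; Node
  0x999888998888888999899999878877 [::]]; Node
  0x999898898988888999999898978878 [:: Node 0x999899988888888a99998988888878
  [::]]]; Node 0xa9a99888889898999998 [:: Node
  0x999889888888888a99998887888887 [:: Node 0x999898898988888999999898978878
  [:: Node 0x999899988888888a99998988888878 [:: Node
  0x99988998888888888888a9999898888887888887 [::]; Node
  0x999888998888888999899999878877 [:: Node
  0x9998899988889888888899989999989898878877 [:: Node
  0x99988998888888888888a9999898888887888887 [:: Node 0x99988888889898889888
  [:: Node 0x88989888889899978878 [::]]]]]]; Node
  0x999888998888888999899999878877 [:: Node
  0x9998899988889888888899989999989898878877 [::]]]; Node
  0x999899988888888a99998988888878 [:: Node
  0x99988998888888888888a9999898888887888887 [::]]; Node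
  0x999888998888888999899999878877 [::]]; Node
  0x999898898988888999999898978878 [:: Node 0x999899988888888a99998988888878
  [::]]]; Node 0xa9a99888889999998988 [:: Node
  0x999889888888888a99998887888887 [:: Node 0x999898898988888999999898978878
  [:: Node 0x999899988888888a99998988888878 [:: Node
  0x99988998888888888888a9999898888887888887 [::]; Node
  0x999888998888888999899999878877 [:: Node
  0x9998899988889888888899989999989898878877 [:: Node
  0x99988998888888888888a9999898888887888887 [:: Node 0x99888888889989888878
  [::]]]]]]; Node 0x999899988888888a99998988888878 [:: Node
  0x99988998888888888888a9999898888887888887 [::]]; Node
  0x999888998888888999899999878877 [::]]]]; Node
  0x999899988888888a99998988888878 [::]; Node 0x999888998888888999899999878877
  [::]]; Node 0x999898898988888999999898978878 [:: Node
  0x999899988888888a99998988888878 [::]]; Node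
  0x999899988888888a99998988888878 [::]]; Node
  0xa9a998998888888999899999888988 [:: Node 0x999898898988888999999898978878
  [:: Node 0x999899988888888a99998988888878 [::]]]; Node
  0x999898898988888999999898978878 [:: Node 0x999899988888888a99998988888878
  [::]]; Node 0x999899988888888a99998988888878 [::]]; Node
  0x999898898988888999999898978878 [:: Node 0x999899988888888a99998988888878
  [:: Node 0x88989888889999977878 [:: Node 0xa9a99a899988888a99999898998998
  [:: Node 0xa9a999899988888999999898998998 [:: Node
  0x999889888888888a99998887888887 [:: Node
  0x99988998888888888888a9999898888887888887 [:: Node
  0xa8999989889888888888a9999a99998787887887 [::]]; Node
  0xa9a998998888888999899999888988 [:: Node
  0x99988998888888888888a9999898888887888887 [:: Node
  0xa8999989889888888888a9999a99998787887887 [::]]; Node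
  0xa9a999998888888999899999898988 [:: Node
  0x99988998888888888888a9999898888887888887 [:: Node
  0xa8999989889888888888a9999a99998787887887 [::]]; Node
  0x999888998888888999899999878877 [:: Node
  0x9998899988889888888899989999989898878877 [:: Node
  0xa8999989999889988888a999aa99a98788887888 [:: Node
  0x99988998888888888888a9999898888887888887 [:: Node
  0xa8999989889888888888a9999a99998787887887 [::]]]; Node
  0x99988998888888888888a9999898888887888887 [:: Node 0x99988888889898889888
  [:: Node 0xa8999989999889988888a999aa99a98788887888 [:: Node
  0xa8999989889888888888a9999a99998787887887 [::]]; Node
  0x89988888889999978877 [:: Node 0xa8999989999889988888a999aa99a98788887888
  [:: Node 0xa8999989889888888888a9999a99998787887887 [::]]]]]]]]]]; Node
  0xa9a998998888888999899999888988 [:: Node 0xa9a999998888888999899999898988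
  [:: Node 0xa9a99888889999998988 [:: Node 0x999889888888888a99998887888887
  [:: Node 0x99988998888888888888a9999898888887888887 [:: Node
  0xa8999989889888888888a9999a99998787887887 [::]]; Node
  0x999888998888888999899999878877 [:: Node
  0x9998899988889888888899989999989898878877 [:: Node
  0xa8999989999889988888a999aa99a98788887888 [:: Node
  0x99988998888888888888a9999898888887888887 [:: Node
  0xa8999989889888888888a9999a99998787887887 [::]]]; Node
  0x99988998888888888888a9999898888887888887 [::]]; Node
  0x89988888889999978877 [:: Node 0x9998899988889888888899989999989898878877
  [:: Node 0x9998999998889888888899999999999898878877 [::]; Node
  0x99988998888888888888a9999898888887888887 [::]]]]]]]; Node
  0x999888998888888999899999878877 [::]]]; Node
  0xa9a998998888888999899999888988 [::]]]; Node 0x88989888888888988988 [::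
  Node 0xa9a99a899988888a99999898998998 [:: Node
  0xa9a999899988888999999898998998 [:: Node 0x999889888888888a99998887888887
  [:: Node 0x99988998888888888888a9999898888887888887 [::]; Node
  0xa99a98989888888998999999888898 [:: Node 0xa9a998998888888999899999888988
  [:: Node 0xa99a9a899988888a99999889998998 [:: Node
  0x998989888888888a99998878888887 [:: Node 0xa99a99899988888999999889998998
  [::]; Node 0x999888998888888999899999878877 [::]]; Node
  0xa9a999998888888999899999898988 [:: Node 0x999888998888888999899999878877
  [::]]]; Node 0xa9a999998888888999899999898988 [:: Node
  0x999888998888888999899999878877 [:: Node
  0x9998899988889888888899989999989898878877 [::]]]]; Node
  0xa99a9a899988888a99999889998998 [:: Node 0x998989888888888a99998878888887
  [:: Node 0xa99a99899988888999999889998998 [:: Node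
  0x99898998888888888888a9999898888878888887 [::]]]]]; Node
  0xa9a998998888888999899999888988 [:: Node
  0x99988998888888888888a9999898888887888887 [::]; Node
  0xa99a9a899988888a99999889998998 [:: Node
  0x99988998888888888888a9999898888887888887 [::]; Node
  0x998989888888888a99998878888887 [:: Node
  0x99988998888888888888a9999898888887888887 [::]; Node
  0x999888998888888999899999878877 [:: Node
  0x99988998888888888888a9999898888887888887 [::]]]; Node
  0xa9a999998888888999899999898988 [:: Node
  0x99988998888888888888a9999898888887888887 [::]]]; Node
  0xa9a999998888888999899999898988 [:: Node
  0x99988998888888888888a9999898888887888887 [::]; Node
  0x999888998888888999899999878877 [:: Node
  0x9998899988889888888899989999989898878877 [:: Node
  0x99988998888888888888a9999898888887888887 [::]]]]]; Node
  0xa99a9a899988888a99999889998998 [:: Node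
  0x99988998888888888888a9999898888887888887 [::]; Node
  0x998989888888888a99998878888887 [:: Node
  0x99988998888888888888a9999898888887888887 [::]; Node
  0xa99a99899988888999999889998998 [:: Node
  0x99898998888888888888a9999898888878888887 [:: Node
  0x99988998888888888888a9999898888887888887 [::]]]]]]; Node
  0xa99a98989888888998999999888898 [:: Node 0xa99a99989888888998999999898898
  [:: Node 0xa9a998998888888999899999888988 [:: Node
  0xa99a9a899988888a99999889998998 [:: Node 0x998989888888888a99998878888887
  [:: Node 0x999888998888888999899999878877 [::]]; Node
  0xa99a99899988888999999889998998 [:: Node 0xa9a999998888888999899999898988
  [::]]]; Node 0xa9a999998888888999899999898988 [::]; Node
  0x999888998888888999899999878877 [::]]]; Node
  0xa9a998998888888999899999888988 [:: Node 0xa99a9a899988888a99999889998998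
  [:: Node 0x998989888888888a99998878888887 [::]; Node
  0xa99a99899988888999999889998998 [::]; Node 0xa9a999998888888999899999898988
  [::]; Node 0x999888998888888999899999878877 [::]]; Node
  0xa9a999998888888999899999898988 [::]; Node 0x999888998888888999899999878877
  [::]]; Node 0xa99a9a899988888a99999889998998 [:: Node
  0x998989888888888a99998878888887 [::]; Node 0xa99a99899988888999999889998998
  [::]]]; Node 0xa9a998998888888999899999888988 [:: Node
  0xa99a9a899988888a99999889998998 [::]; Node 0xa9a999998888888999899999898988
  [::]; Node 0x999888998888888999899999878877 [::]]; Node
  0xa99a9a899988888a99999889998998 [:: Node 0x998989888888888a99998878888887
  [::]; Node 0xa99a99899988888999999889998998 [::]]]; Node
  0xa99a98989888888998999999888898 [:: Node 0xa9a998998888888999899999888988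
  [:: Node 0xa99a9a899988888a99999889998998 [::]]]; Node
  0xa9a998998888888999899999888988 [::]; Node 0xa99a9a899988888a99999889998998
  [::]]]; Node 0x88989888889898978888 [:: Node
  0xa9a99a899988888a99999898998998 [:: Node 0xa9a999899988888999999898998998
  [:: Node 0x999889888888888a99998887888887 [:: Node
  0x99988998888888888888a9999898888887888887 [::]; Node
  0xa9a998998888888999899999888988 [:: Node
  0x99988998888888888888a9999898888887888887 [::]; Node
  0xa9a999998888888999899999898988 [:: Node
  0x99988998888888888888a9999898888887888887 [::]; Node
  0x999888998888888999899999878877 [:: Node
  0x9998899988889888888899989999989898878877 [:: Node
  0x99988998888888888888a9999898888887888887 [:: Node 0x99988888889999888878
  [:: Node 0x89988888889999978877 [::]]]]]]; Node
  0x999888998888888999899999878877 [:: Node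
  0x99988998888888888888a9999898888887888887 [::]]]]; Node
  0xa9a998998888888999899999888988 [:: Node 0xa9a999998888888999899999898988
  [:: Node 0xa9a99888889898999998 [:: Node 0x999889888888888a99998887888887
  [:: Node 0x99988998888888888888a9999898888887888887 [::]; Node
  0x999888998888888999899999878877 [:: Node
  0x9998899988889888888899989999989898878877 [:: Node
  0x99988998888888888888a9999898888887888887 [::]]]]]]; Node
  0x999888998888888999899999878877 [::]]]; Node
  0x999889888888888a99998887888887 [:: Node 0xa9a998998888888999899999888988
  [:: Node 0x999888998888888999899999878877 [:: Node 0x89988888889999878878
  [:: Node 0xa9a999899988888999999898998998 [:: Node
  0x99988998888888888888a9999898888887888887 [::]; Node
  0xa9a999998888888999899999898988 [:: Node
  0x9998899988889888888899989999989898878877 [:: Node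
  0x99988998888888888888a9999898888887888887 [::]]]]]]]]; Node
  0xa9a998998888888999899999888988 [::]]]]]]; Node 0x88899888889889978888 [::
  Node 0x999898898988888999999898978878 [:: Node
  0x999899988888888a99998988888878 [:: Node 0x88989888889999977878 [::]; Node
  0x88989888889898978888 [::]; Node 0x88989888889899978878 [::]]]]; Node
  0x88899888889999977788 [:: Node 0x999898898988888999999898978878 [:: Node
  0x999899988888888a99998988888878 [:: Node 0x88989888889999977878 [::]]]]]]];
  Node 0x88998888889899978887 [:: Node 0x998999988888888a99998988888788 [::
  Node 0x999898898988888999999898978878 [:: Node
  0x999899988888888a99998988888878 [:: Node 0x998998889988888999999889978788
  [::]]]; Node 0x999899988888888a99998988888878 [::]; Node
  0x998998889988888999999889978788 [:: Node 0x88899888888888988898 [:: Node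
  0xa9a99a899988888a99999898998998 [:: Node 0xa9a999899988888999999898998998
  [:: Node 0x999889888888888a99998887888887 [:: Node
  0xa9a998998888888999899999888988 [:: Node 0x999898898988888999999898978878
  [:: Node 0xa9a999998888888999899999898988 [:: Node
  0x999899988888888a99998988888878 [:: Node
  0x99988998888888888888a9999898888887888887 [::]; Node
  0x999888998888888999899999878877 [:: Node
  0x9998899988889888888899989999989898878877 [:: Node
  0x99988998888888888888a9999898888887888887 [:: Node 0x99888888889988988887
  [::]; Node 0x99988888889999888878 [::]; Node 0x99988888889898889888 [::];
  Node 0x99988888889998988887 [:: Node
  0xa99a9a89999889988888a999a989999889898898 [:: Node
  0xa99a999998898988888899999999999989888897 [::]; Node
  0xa99a9a899988888a99999899998898 [:: Node
  0xa99a999998898988888899999999999989888897 [:: Node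
  0xa99a98989888888999999989888898 [::]]]]]]]]]; Node
  0x999888998888888999899999878877 [:: Node
  0x9998899988889888888899989999989898878877 [::]]]; Node
  0x999899988888888a99998988888878 [:: Node
  0x99988998888888888888a9999898888887888887 [::]; Node
  0x999888998888888999899999878877 [:: Node
  0x99988998888888888888a9999898888887888887 [::]]]; Node
  0x999888998888888999899999878877 [::]]; Node
  0xa9a999998888888999899999898988 [:: Node 0x999899988888888a99998988888878
  [:: Node 0x99988998888888888888a9999898888887888887 [::]]; Node
  0x999888998888888999899999878877 [::]]; Node
  0x999899988888888a99998988888878 [:: Node
  0x99988998888888888888a9999898888887888887 [::]; Node
  0x999888998888888999899999878877 [:: Node
  0x99988998888888888888a9999898888887888887 [::]]]; Node
  0x999888998888888999899999878877 [::]]; Node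
  0x999898898988888999999898978878 [:: Node 0x999899988888888a99998988888878
  [:: Node 0x99988998888888888888a9999898888887888887 [::]]]; Node
  0x999899988888888a99998988888878 [:: Node
  0x99988998888888888888a9999898888887888887 [::]]]; Node
  0xa9a998998888888999899999888988 [:: Node 0x999898898988888999999898978878
  [:: Node 0xa9a999998888888999899999898988 [:: Node
  0x999899988888888a99998988888878 [::]]; Node
  0x999899988888888a99998988888878 [:: Node 0x999888998888888999899999878877
  [::]]; Node 0x999888998888888999899999878877 [::]]; Node
  0xa9a999998888888999899999898988 [:: Node 0xa9a99888889898999998 [:: Node
  0x999889888888888a99998887888887 [:: Node 0x999898898988888999999898978878
  [:: Node 0x999899988888888a99998988888878 [:: Node
  0x99988998888888888888a9999898888887888887 [:: Node
  0x99989998898988988888a999a888798988889888 [::]]; Node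
  0x999888998888888999899999878877 [:: Node
  0x9998899988889888888899989999989898878877 [:: Node
  0x9998998988889888888898989989899999878877 [:: Node
  0x99988998888888888888a9999898888887888887 [:: Node
  0x99989998898988988888a999a888798988889888 [::]]]; Node
  0x99988998888888888888a9999898888887888887 [::]]]]]; Node
  0x999899988888888a99998988888878 [:: Node
  0x99988998888888888888a9999898888887888887 [:: Node
  0x99989998898988988888a999a888798988889888 [::]]]; Node
  0x999888998888888999899999878877 [::]]]]; Node
  0x999899988888888a99998988888878 [:: Node 0x999888998888888999899999878877
  [::]]; Node 0x999888998888888999899999878877 [::]]; Node
  0x999898898988888999999898978878 [:: Node 0x999899988888888a99998988888878
  [::]]; Node 0x999899988888888a99998988888878 [::]]; Node
  0x999889888888888a99998887888887 [:: Node 0xa9a998998888888999899999888988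
  [:: Node 0x999898898988888999999898978878 [:: Node
  0x999899988888888a99998988888878 [:: Node 0x999888998888888999899999878877
  [::]]; Node 0x999888998888888999899999878877 [::]]; Node
  0x999899988888888a99998988888878 [::]; Node 0x999888998888888999899999878877
  [::]]; Node 0x999898898988888999999898978878 [:: Node
  0x999899988888888a99998988888878 [::]]; Node
  0x999899988888888a99998988888878 [::]]; Node
  0xa9a998998888888999899999888988 [:: Node 0x999898898988888999999898978878
  [:: Node 0x999899988888888a99998988888878 [::]]]; Node
  0x999898898988888999999898978878 [:: Node 0x999899988888888a99998988888878
  [::]]; Node 0x999899988888888a99998988888878 [::]]; Node
  0x999898898988888999999898978878 [:: Node 0x999899988888888a99998988888878
  [:: Node 0x88989888889898978888 [:: Node 0xa9a99a899988888a99999898998998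
  [:: Node 0xa9a999899988888999999898998998 [:: Node
  0x999889888888888a99998887888887 [:: Node
  0x99988998888888888888a9999898888887888887 [::]; Node
  0xa9a998998888888999899999888988 [:: Node
  0x99988998888888888888a9999898888887888887 [::]; Node
  0xa9a999998888888999899999898988 [:: Node
  0x99988998888888888888a9999898888887888887 [::]; Node
  0x999888998888888999899999878877 [:: Node
  0x9998899988889888888899989999989898878877 [:: Node
  0x99988998888888888888a9999898888887888887 [::]]]]]]; Node
  0xa9a998998888888999899999888988 [:: Node 0xa9a999998888888999899999898988
  [::]; Node 0x999888998888888999899999878877 [::]]]; Node
  0xa9a998998888888999899999888988 [::]]]]]]; Node 0x88899888889889978888 [::
  Node 0x999898898988888999999898978878 [:: Node
  0x999899988888888a99998988888878 [:: Node 0x88989888889898978888 [::]]]];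
  Node 0x88899888889899978788 [:: Node 0x999898898988888999999898978878 [::
  Node 0x999899988888888a99998988888878 [:: Node 0x88989888889899978878
  [::]]]]]]]; Node 0x88998888888889888988 [:: Node
  0x998999988888888a99998988888788 [:: Node 0x999898898988888999999898978878
  [:: Node 0x999899988888888a99998988888878 [:: Node
  0xa999a8988988888998999998988889 [:: Node 0xa999a9988988888998999998998889
  [:: Node 0x998898988988888998999998978778 [:: Node
  0xa999aa899988888a99999889998989 [:: Node 0xa999a9899988888999999889998989
  [:: Node 0x998899888888888a99998878888878 [:: Node
  0x99889998888888888888a9999898888878888878 [::]; Node
  0x998998889988888999999889978788 [:: Node
  0x99889998888888888888a9999898888878888878 [:: Node
  0x9988999889888898888899899999899888978778 [:: Node 0x99889888889888989888
  [:: Node 0x99888888889998888788 [::]; Node 0x88899888889889978888 [::]];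
  Node 0x99889888889998988788 [:: Node
  0xa99a9a89999899888888a9a99989999889898898 [:: Node
  0xa99a999899898988888899999999999989888798 [::]; Node
  0xa99a9a899988888a99999899998898 [:: Node
  0xa99a999899898988888899999999999989888798 [:: Node
  0xa89999888988888988999898998888 [::]; Node 0xa99a98989888888999999989888898
  [::]]; Node 0xa89999899888888989999889898988 [:: Node
  0xa99a999899898988888899999999999989888798 [:: Node
  0xa89999888988888988999898998888 [:: Node 0xa99a98989888888999999989888898
  [::]]; Node 0xa99a98989888888999999989888898 [::]]; Node
  0xa9a99a899988888a99999899998988 [:: Node
  0xa99a999899898988888899999999999989888798 [:: Node
  0xa89999888988888988999898998888 [:: Node 0xa99a98989888888999999989888898
  [:: Node 0xa9a998998888888999999998888988 [::]]]; Node
  0xa99a98989888888999999989888898 [::]]]]]; Node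
  0xa89999899888888989999889898988 [:: Node
  0xa99a999899898988888899999999999989888798 [:: Node
  0xa89999888988888988999898998888 [::]]]]; Node 0x99888888888988898888 [::
  Node 0xa99a9a9a9998999888889999999999a899998998 [:: Node
  0xa99a999899898988888899999999999989888798 [::]; Node
  0xa99a999898887988888899899898989889898898 [::]; Node
  0x998989998888888a99998988888887 [:: Node
  0xa99a999899898988888899999999999989888798 [:: Node
  0xa89999888988888988999898998888 [::]]; Node
  0xa99a999898887988888899899898989889898898 [:: Node
  0x998988879888888998999889878787 [::]]]]]; Node 0x99888888889989888878 [::
  Node 0xa99a9a89999899888888a9a99989999889898898 [:: Node
  0xa99a999899898988888899999999999989888798 [::]; Node
  0xa89999899888888989999889898988 [:: Node
  0xa99a999899898988888899999999999989888798 [:: Node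
  0xa89999888988888988999898998888 [::]]]]]]]]]]]; Node
  0x998998889988888999999889978788 [:: Node
  0x9988999889888898888899899999899888978778 [::]]]; Node
  0x998998889988888999999889978788 [:: Node
  0x9988999889888898888899899999899888978778 [::]]]; Node
  0xa999aa899988888a99999889998989 [:: Node 0xa999a9899988888999999889998989
  [:: Node 0x998899888888888a99998878888878 [:: Node
  0x99889998888888888888a9999898888878888878 [::]]; Node
  0x998998889988888999999889978788 [::]]; Node
  0x998899888888888a99998878888878 [:: Node 0x998998889988888999999889978788
  [::]]; Node 0x998998889988888999999889978788 [::]]; Node
  0x998998889988888999999889978788 [::]]; Node
  0xa999aa899988888a99999889998989 [:: Node 0xa999a9899988888999999889998989
  [:: Node 0x998899888888888a99998878888878 [:: Node
  0x99889998888888888888a9999898888878888878 [::]]]; Node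
  0x998998889988888999999889978788 [::]]; Node
  0x998998889988888999999889978788 [::]]; Node
  0xa999aa899988888a99999889998989 [:: Node 0xa999a9899988888999999889998989
  [:: Node 0x998899888888888a99998878888878 [:: Node
  0x99889998888888888888a9999898888878888878 [::]]]]; Node
  0x998998889988888999999889978788 [::]]; Node
  0xa999a8988988888998999998988889 [:: Node 0xa999a9988988888998999998998889
  [:: Node 0x998898988988888998999998978778 [:: Node
  0xa999aa899988888a99999889998989 [::]]; Node
  0xa999aa899988888a99999889998989 [:: Node 0xa999a9899988888999999889998989
  [::]; Node 0x998899888888888a99998878888878 [::]]]; Node
  0xa999aa899988888a99999889998989 [::]]]; Node
  0x999899988888888a99998988888878 [:: Node 0xa999a8988988888998999998988889
  [:: Node 0xa999a9988988888998999998998889 [:: Node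
  0x998898988988888998999998978778 [:: Node 0xa89999899888888989999889898988
  [::]; Node 0xa999aa899988888a99999889998989 [::]]; Node
  0xa89999899888888989999889898988 [::]; Node 0xa999aa899988888a99999889998989
  [:: Node 0xa999a9899988888999999889998989 [::]]]; Node
  0xa89999899888888989999889898988 [::]; Node 0xa999aa899988888a99999889998989
  [:: Node 0xa999a9899988888999999889998989 [:: Node
  0x998899888888888a99998878888878 [:: Node
  0x99889998888888888888a9999898888878888878 [::]]]]]; Node
  0xa999aa899988888a99999889998989 [:: Node 0xa999a9899988888999999889998989
  [:: Node 0x998899888888888a99998878888878 [:: Node
  0x99889998888888888888a9999898888878888878 [::]]]]]; Node
  0xa999a8988988888998999998988889 [:: Node 0xa999a9988988888998999998998889
  [:: Node 0x998898988988888998999998978778 [:: Node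
  0x998998889988888999999889978788 [::]]; Node
  0xa89999899888888989999889898988 [::]; Node 0xa999aa899988888a99999889998989
  [:: Node 0xa999a9899988888999999889998989 [:: Node
  0x998998889988888999999889978788 [::]]]; Node
  0x998998889988888999999889978788 [::]]; Node
  0xa89999899888888989999889898988 [::]; Node 0xa999aa899988888a99999889998989
  [:: Node 0xa999a9899988888999999889998989 [::]; Node
  0x998998889988888999999889978788 [::]]; Node
  0x998998889988888999999889978788 [::]]; Node
  0xa999aa899988888a99999889998989 [:: Node 0xa999a9899988888999999889998989
  [:: Node 0x998899888888888a99998878888878 [::]]]; Node
  0x998998889988888999999889978788 [:: Node 0x88899888888888988898 [:: Node
  0xa9a99a899988888a99999898998998 [:: Node 0xa9a999899988888999999898998998
  [:: Node 0x999889888888888a99998887888887 [:: Node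
  0xa9a998998888888999899999888988 [:: Node 0x999898898988888999999898978878
  [:: Node 0xa9a999998888888999899999898988 [:: Node
  0x999899988888888a99998988888878 [:: Node
  0x99988998888888888888a9999898888887888887 [::]; Node
  0x999888998888888999899999878877 [:: Node
  0x9998899988889888888899989999989898878877 [:: Node
  0x99988998888888888888a9999898888887888887 [:: Node 0x99888888889988988887
  [::]; Node 0x99988888889998988887 [:: Node
  0xa99a9a89999889988888a999a989999889898898 [:: Node
  0xa99a999998898988888899999999999989888897 [::]; Node
  0xa99a9a899988888a99999899998898 [:: Node
  0xa99a999998898988888899999999999989888897 [:: Node
  0xa99a98989888888999999989888898 [::]]]]]]]]]; Node
  0x999888998888888999899999878877 [:: Node
  0x9998899988889888888899989999989898878877 [::]]]; Node
  0x999899988888888a99998988888878 [:: Node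
  0x99988998888888888888a9999898888887888887 [::]; Node
  0xa999a8988988888998999998988889 [::]; Node 0xa999aa899988888a99999889998989
  [:: Node 0x99988998888888888888a9999898888887888887 [::]]]; Node
  0xa999a8988988888998999998988889 [::]; Node 0xa999aa899988888a99999889998989
  [::]]; Node 0xa9a999998888888999899999898988 [:: Node
  0x999899988888888a99998988888878 [:: Node
  0x99988998888888888888a9999898888887888887 [::]]; Node
  0x999888998888888999899999878877 [::]]; Node
  0x999899988888888a99998988888878 [:: Node
  0x99988998888888888888a9999898888887888887 [::]; Node
  0xa999a8988988888998999998988889 [::]; Node 0xa999aa899988888a99999889998989
  [:: Node 0x99988998888888888888a9999898888887888887 [::]]]; Node
  0xa999a8988988888998999998988889 [::]; Node 0xa999aa899988888a99999889998989
  [::]]; Node 0x999898898988888999999898978878 [:: Node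
  0x999899988888888a99998988888878 [:: Node
  0x99988998888888888888a9999898888887888887 [::]; Node
  0xa999a8988988888998999998988889 [:: Node 0xa999aa899988888a99999889998989
  [::]]; Node 0xa999aa899988888a99999889998989 [:: Node
  0x99988998888888888888a9999898888887888887 [::]; Node
  0xa999a9899988888999999889998989 [:: Node
  0x99988998888888888888a9999898888887888887 [::]; Node
  0x998899888888888a99998878888878 [:: Node
  0x99889998888888888888a9999898888878888878 [:: Node
  0x99988998888888888888a9999898888887888887 [::]]]]]]; Node
  0xa999a8988988888998999998988889 [:: Node 0xa999aa899988888a99999889998989
  [::]]; Node 0xa999aa899988888a99999889998989 [:: Node
  0xa999a9899988888999999889998989 [:: Node 0x998899888888888a99998878888878
  [::]]]]; Node 0x999899988888888a99998988888878 [:: Node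
  0x99988998888888888888a9999898888887888887 [::]; Node
  0xa999a8988988888998999998988889 [:: Node 0xa999aa899988888a99999889998989
  [::]]; Node 0xa999aa899988888a99999889998989 [:: Node
  0x99988998888888888888a9999898888887888887 [::]; Node
  0xa999a9899988888999999889998989 [:: Node
  0x99988998888888888888a9999898888887888887 [::]; Node
  0x998899888888888a99998878888878 [:: Node
  0x99889998888888888888a9999898888878888878 [:: Node
  0x99988998888888888888a9999898888887888887 [::]]]]]]; Node
  0xa999a8988988888998999998988889 [:: Node 0xa999aa899988888a99999889998989
  [::]]; Node 0xa999aa899988888a99999889998989 [:: Node
  0xa999a9899988888999999889998989 [:: Node 0x998899888888888a99998878888878
  [::]]]]; Node 0xa9a998998888888999899999888988 [:: Node
  0x999898898988888999999898978878 [:: Node 0xa9a999998888888999899999898988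
  [:: Node 0x999899988888888a99998988888878 [::]]; Node
  0x999899988888888a99998988888878 [:: Node 0x999888998888888999899999878877
  [::]; Node 0xa999a8988988888998999998988889 [::]; Node
  0xa999aa899988888a99999889998989 [::]]; Node
  0x999888998888888999899999878877 [::]; Node 0xa999a8988988888998999998988889
  [::]; Node 0xa999aa899988888a99999889998989 [::]]; Node
  0xa9a999998888888999899999898988 [::]; Node 0x999899988888888a99998988888878
  [:: Node 0xa999aa899988888a99999889998989 [::]]; Node
  0x999888998888888999899999878877 [::]; Node 0xa999a8988988888998999998988889
  [::]; Node 0xa999aa899988888a99999889998989 [::]]; Node
  0x999898898988888999999898978878 [:: Node 0x999899988888888a99998988888878
  [:: Node 0xa999a8988988888998999998988889 [:: Node
  0xa999a9988988888998999998998889 [::]; Node 0xa999aa899988888a99999889998989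
  [::]]; Node 0xa999aa899988888a99999889998989 [:: Node
  0xa999a9899988888999999889998989 [::]; Node 0x998899888888888a99998878888878
  [::]]]; Node 0xa999a8988988888998999998988889 [:: Node
  0xa999a9988988888998999998998889 [::]; Node 0xa999aa899988888a99999889998989
  [::]]; Node 0xa999aa899988888a99999889998989 [:: Node
  0xa999a9899988888999999889998989 [::]; Node 0x998899888888888a99998878888878
  [::]]]; Node 0x999899988888888a99998988888878 [:: Node
  0xa999a8988988888998999998988889 [:: Node 0xa999aa899988888a99999889998989
  [::]]; Node 0xa999aa899988888a99999889998989 [:: Node
  0xa999a9899988888999999889998989 [::]; Node 0x998899888888888a99998878888878
  [::]]]; Node 0xa999a8988988888998999998988889 [:: Node
  0xa999a9988988888998999998998889 [::]; Node 0xa999aa899988888a99999889998989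
  [::]]; Node 0xa999aa899988888a99999889998989 [:: Node
  0xa999a9899988888999999889998989 [::]; Node 0x998899888888888a99998878888878
  [::]]]; Node 0xa9a998998888888999899999888988 [:: Node
  0x999898898988888999999898978878 [:: Node 0x999899988888888a99998988888878
  [:: Node 0xa999a8988988888998999998988889 [:: Node
  0xa999aa899988888a99999889998989 [::]]]; Node
  0xa999a8988988888998999998988889 [:: Node 0xa999aa899988888a99999889998989
  [::]]; Node 0xa999aa899988888a99999889998989 [::]]; Node
  0xa999a8988988888998999998988889 [:: Node 0xa999aa899988888a99999889998989
  [::]]]; Node 0x999898898988888999999898978878 [:: Node
  0x999899988888888a99998988888878 [:: Node 0xa999a8988988888998999998988889
  [::]; Node 0xa999aa899988888a99999889998989 [::]]; Node
  0xa999a8988988888998999998988889 [::]; Node 0xa999aa899988888a99999889998989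
  [::]]; Node 0x999899988888888a99998988888878 [:: Node
  0xa999aa899988888a99999889998989 [::]]; Node
  0xa999a8988988888998999998988889 [::]; Node 0xa999aa899988888a99999889998989
  [::]]; Node 0x999898898988888999999898978878 [:: Node
  0x999899988888888a99998988888878 [:: Node 0x88989888888888988988 [:: Node
  0xa9a99a899988888a99999898998998 [:: Node 0xa9a999899988888999999898998998
  [:: Node 0x999889888888888a99998887888887 [:: Node
  0x99988998888888888888a9999898888887888887 [::]; Node
  0xa99a98989888888998999999888898 [:: Node 0xa9a998998888888999899999888988
  [:: Node 0xa999a8988988888998999998988889 [::]; Node
  0xa999aa899988888a99999889998989 [::]]; Node
  0xa99a9a899988888a99999889998998 [:: Node 0xa999a8988988888998999998988889
  [::]; Node 0xa999aa899988888a99999889998989 [:: Node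
  0xa999a9899988888999999889998989 [:: Node 0x998899888888888a99998878888878
  [::]]]]; Node 0xa999a8988988888998999998988889 [::]; Node
  0xa999aa899988888a99999889998989 [:: Node 0xa999a9899988888999999889998989
  [:: Node 0x998899888888888a99998878888878 [::]]]]; Node
  0xa9a998998888888999899999888988 [:: Node
  0x99988998888888888888a9999898888887888887 [::]; Node
  0xa99a9a899988888a99999889998998 [:: Node
  0x99988998888888888888a9999898888887888887 [::]; Node
  0xa999aa899988888a99999889998989 [:: Node
  0x99988998888888888888a9999898888887888887 [::]]]; Node
  0xa9a999998888888999899999898988 [:: Node
  0x99988998888888888888a9999898888887888887 [::]; Node
  0x999888998888888999899999878877 [:: Node
  0x9998899988889888888899989999989898878877 [:: Node
  0x99988998888888888888a9999898888887888887 [::]]]]]; Node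
  0xa99a9a899988888a99999889998998 [:: Node
  0x99988998888888888888a9999898888887888887 [::]; Node
  0x998989888888888a99998878888887 [:: Node
  0x99988998888888888888a9999898888887888887 [::]; Node
  0xa99a99899988888999999889998998 [:: Node
  0x99898998888888888888a9999898888878888887 [:: Node
  0x99988998888888888888a9999898888887888887 [::]]; Node
  0xa999aa899988888a99999889998989 [:: Node
  0x99898998888888888888a9999898888878888887 [:: Node
  0x99988998888888888888a9999898888887888887 [::]]; Node
  0xa999a9899988888999999889998989 [:: Node
  0x99898998888888888888a9999898888878888887 [:: Node
  0x99988998888888888888a9999898888887888887 [::]]; Node
  0xa89999899988888988999898998998 [:: Node
  0xa999998999989998888899999988999898998998 [:: Node
  0x99898998888888888888a9999898888878888887 [:: Node
  0x99988998888888888888a9999898888887888887 [::]]]; Node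
  0x998899888888888a99998878888878 [:: Node
  0xa999998999989998888899999988999898998998 [:: Node
  0x99889998888888888888a9999898888878888878 [:: Node
  0x99888988888888888888a9999887888887888887 [:: Node
  0x99898998888888888888a9999898888878888887 [:: Node
  0x99988998888888888888a9999898888887888887 [:: Node
  0x9988899888888888888888888a999989888887888887888887 [::]]]]]]]]]]]; Node
  0xa999aa899988888a99999889998989 [:: Node
  0x99988998888888888888a9999898888887888887 [::]; Node
  0xa999a9899988888999999889998989 [:: Node
  0x99988998888888888888a9999898888887888887 [::]; Node
  0xa89999899988888988999898998998 [:: Node
  0x99988998888888888888a9999898888887888887 [::]]]; Node
  0x998899888888888a99998878888878 [:: Node
  0x99988998888888888888a9999898888887888887 [::]]]]; Node
  0xa999aa899988888a99999889998989 [:: Node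
  0x99988998888888888888a9999898888887888887 [::]; Node
  0xa89999899988888988999898998998 [:: Node
  0x99988998888888888888a9999898888887888887 [::]]]]]; Node
  0xa99a98989888888998999999888898 [:: Node 0xa99a99989888888998999999898898
  [:: Node 0xa999a8988988888998999998988889 [:: Node
  0xa999a9988988888998999998998889 [::]; Node 0xa999aa899988888a99999889998989
  [::]]]; Node 0xa9a998998888888999899999888988 [:: Node
  0xa999a8988988888998999998988889 [::]]; Node
  0xa99a9a899988888a99999889998998 [:: Node 0xa999a8988988888998999998988889
  [:: Node 0xa999aa899988888a99999889998989 [::]]; Node
  0xa999aa899988888a99999889998989 [:: Node 0xa999a9899988888999999889998989
  [::]; Node 0xa89999899988888988999898998998 [:: Node
  0x998899888888888a99998878888878 [::]]]]; Node
  0xa999a8988988888998999998988889 [::]; Node 0xa999aa899988888a99999889998989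
  [:: Node 0xa999a9899988888999999889998989 [::]; Node
  0x998899888888888a99998878888878 [::]]]; Node
  0xa9a998998888888999899999888988 [:: Node 0xa99a9a899988888a99999889998998
  [:: Node 0xa999aa899988888a99999889998989 [::]]; Node
  0xa9a999998888888999899999898988 [::]; Node 0x999888998888888999899999878877
  [::]]; Node 0xa99a9a899988888a99999889998998 [:: Node
  0x998989888888888a99998878888887 [:: Node 0xa999aa899988888a99999889998989
  [:: Node 0xa999a9899988888999999889998989 [:: Node
  0xa89999899988888988999898998998 [::]]; Node
  0xa89999899988888988999898998998 [::]]]; Node
  0xa99a99899988888999999889998998 [:: Node 0xa999aa899988888a99999889998989
  [:: Node 0xa999a9899988888999999889998989 [::]]]; Node
  0xa999aa899988888a99999889998989 [:: Node 0xa89999899988888988999898998998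
  [::]]]]; Node 0xa99a98989888888998999999888898 [:: Node
  0xa9a998998888888999899999888988 [:: Node 0xa99a9a899988888a99999889998998
  [:: Node 0xa999a8988988888998999998988889 [:: Node
  0xa999aa899988888a99999889998989 [::]]]; Node
  0xa999a8988988888998999998988889 [:: Node 0xa89999888888888988899889898988
  [::]]; Node 0xa999aa899988888a99999889998989 [::]]; Node
  0xa999a8988988888998999998988889 [::]]; Node
  0xa9a998998888888999899999888988 [::]; Node 0xa99a9a899988888a99999889998998
  [:: Node 0xa999aa899988888a99999889998989 [:: Node
  0xa89999899988888988999898998998 [::]]]]]]]]]]; Node
  0xa999a8988988888998999998988889 [:: Node 0xa999a9988988888998999998998889
  [:: Node 0x998898988988888998999998978778 [::]]; Node
  0xa89999899888888989999889898988 [::]; Node 0xa999aa899988888a99999889998989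
  [::]]]]]]; Node 0x89998888889999878888 [:: Node
  0x998999988888888a99998988888788 [:: Node 0x999899888988888a99998888988878
  [:: Node 0x999898898988888999999898978878 [:: Node
  0x999899988888888a99998988888878 [::]; Node 0x998998989888888999999989878788
  [::]]; Node 0x999899988888888a99998988888878 [:: Node
  0x998999888988888a99998888988788 [::]]]; Node
  0x999898898988888999999898978878 [:: Node 0x999899988888888a99998988888878
  [:: Node 0x998998889988888999999889978788 [::]]]; Node
  0x999899988888888a99998988888878 [::]; Node 0x998998889988888999999889978788
  [:: Node 0x88899888888888988898 [:: Node 0xa9a99a899988888a99999898998998
  [:: Node 0xa9a999899988888999999898998998 [:: Node
  0x999898898988888999999898978878 [:: Node 0xa89999898888888989899899898888
  [:: Node 0x998998989888888999999989878788 [::]]]; Node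
  0x999899988888888a99998988888878 [::]; Node 0xa89999898888888989899899898888
  [::]]; Node 0x999898898988888999999898978878 [::]; Node
  0xa9a998998888888999899999888988 [::]; Node 0x999899988888888a99998988888878
  [::]]; Node 0x999898898988888999999898978878 [:: Node
  0x999899988888888a99998988888878 [::]; Node 0x998998989888888999999989878788
  [::]]]; Node 0x88899888889889978888 [:: Node
  0x999898898988888999999898978878 [:: Node 0x999899988888888a99998988888878
  [:: Node 0x88989888889999977878 [::]; Node 0x88989888889898978888 [::]; Node
  0x88989888889899978878 [::]]; Node 0x998998989888888999999989878788 [::]];
  Node 0x998998989888888999999989878788 [:: Node
  0x998999888988888a99998888988788 [:: Node 0x89898888889989878888 [::]]]];
  Node 0x88899888889899978788 [:: Node 0x999898898988888999999898978878 [::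
  Node 0x999899988888888a99998988888878 [::]; Node
  0x998998989888888999999989878788 [::]]]]]]]]; Node 0x88999888889999977888
  [:: Node 0x89899888889999978788 [:: Node 0x89998888889999978887 [::]]]]]])%coqZ.

Definition kuhn_table : table := foldl insert empty_table (allkeys kuhn).

Definition triangulations : option (seq triangulation) :=
  gather (fun T => explore T kuhn kuhn_table) [:: (kuhn_table.2, kuhn)] flips.

(** One evaluation replays all flips with their tests and compares all pairs of results. *)
Lemma triangulations_differ :
  if triangulations is Some s then (size s == 950%N) && pairwise differ s else false.
Proof. by vm_compute. Qed.

Lemma triangulations_correct (R : realType) s :
  triangulations = Some s -> List.Forall (correct (@embed R)) s.
Proof.
have tK : tabulates kuhn_table (allkeys kuhn).
  by have := tabulates_inserts (allkeys kuhn) tabulates_empty; rewrite cats0.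
have cK : correct (@embed R) (kuhn_table.2, kuhn).
  exact (conj (kuhn_valid R) (etrans tK.2 (profile_keys (kuhn_valid R)))).
apply: (gather_Forall (List.Forall_cons _ cK (List.Forall_nil _))) => T r _.
exact: explore_correct (kuhn_valid R) tK.
Qed.

Theorem theorem7p2 (R : realType) :
  exists T : 'I_950 -> set (set 'cV[R]_5),
    (forall i, periodic_triangulation (T i)) /\
    (forall i j, i != j -> ~ gl_equivalent (T i) (T j)).
Proof.
move: triangulations_differ (@triangulations_correct R).
case: triangulations => [s|//] /andP[/eqP sz dif] /(_ s erefl) cor.
pose d : triangulation := (0%coqZ, [::]).
have nth_cor i : (i < 950)%N -> correct (@embed R) (nth d s i).
  rewrite -sz; elim: cor i {sz dif} => [//|a r ca cr IH] [|i] //=; exact: IH.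
exists (fun i => cells_of (@embed R) (nth d s i).2); split.
  move=> i; have [[[good _] _] _] := nth_cor i (ltn_ord i).
  exact: (cells_of_triangulation int_ptK (@embedE R) good).
(* [pairwise] compares an entry with later ones only; [differC] supplies the other order. *)
have lt_differ (i j : 'I_950) : (i < j)%N -> differ (nth d s i) (nth d s j).
  by move=> ij; apply: (pairwiseP d dif); rewrite ?inE ?sz.
move=> i j; rewrite neq_ltn => ij.
apply: (differ_correct (nth_cor i (ltn_ord i)) (nth_cor j (ltn_ord j))).
by case/orP: ij => /lt_differ d_ij; rewrite // differC.
Qed.
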